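(* Let $n\ge 3$ and work in the formal, real analytic or holomorphic category. Let $f\in\mathcal F(\mathbb K^n)$ be a quasihomogeneous polynomial with $f(0)=0$ and of finite codimension. If $k\in\{2,\dots,n-2\}$ then $H^k_f(\mathbb K^n)=\{0\}$.
   Context: $\mathbb K=\mathbb R$ or $\mathbb C$. $\mathcal F(\mathbb K^n)$ and $\Omega^k(\mathbb K^n)$ denote the spaces of germs at $0$ of functions and $k$-forms in the chosen category (formal power series, and forms with such coefficients, in the formal case). $f$ is of finite codimension if $Q_f=\mathcal F(\mathbb K^n)/I_f$ is finite dimensional, $I_f$ being the ideal generated by the partial derivatives of $f$. $f$ is quasihomogeneous of degree $\mathrm N$ if there are positive integers $w_1,\dots,w_n$ such that $W.f=\mathrm N f$ with $W=\sum_iw_ix_i\frac{\partial}{\partial x_i}$. $d_f:\Omega^k(\mathbb K^n)\to\Omega^{k+1}(\mathbb K^n)$ is $d_f\alpha=f\,d\alpha-k\,df\wedge\alpha$, which satisfies $d_f\circ d_f=0$, and $H^k_f(\mathbb K^n)$ is the $k$-th cohomology space of $(\Omega^\bullet(\mathbb K^n),d_f)$. *)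

(* Defs.v *)
(* the notations of mpoly clash with those of MathComp-Analysis *)
From mathcomp Require mpoly.
Import -(notations) mpoly.
From HB Require Import structures.
From mathcomp Require Import all_boot all_order all_algebra.
From mathcomp Require Import all_classical all_reals all_analysis.
From mathcomp Require Import complex.
Set Implicit Arguments.
Unset Strict Implicit.
Unset Printing Implicit Defensive.
Import Order.TTheory GRing.Theory Num.Theory.
Import numFieldNormedType.Exports.

Local Open Scope classical_set_scope.
Local Open Scope ring_scope.

Notation multi_index := multinom.
Notation "{ 'mpol' K [ n ] }" := (mpoly n K)
  (at level 0, K at level 2, n at level 2, format "{ 'mpol'  K [ n ] }").

(* Germs at 0 are handled through representatives: [germ g] says that g
   represents a germ of the category, and [same g h] that g and h have the same
   germ.  The type [rep] may contain elements that represent no germ. *)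
Record category (K : numFieldType) (n : nat) := Category {
  rep : lmodType K;
  germ : rep -> Prop;
  same : rep -> rep -> Prop;
  gmul : rep -> rep -> rep;
  pder : 'I_n -> rep -> rep;
  of_poly : {mpol K[n]} -> rep
}.

Arguments gmul {K n c}.
Arguments pder {K n c}.

Section FormalSeries.
Variables (K : numFieldType) (n : nat).

Definition fps : Type := multi_index n -> K.

Definition fps_mul (a b : fps) : fps := fun m =>
  let d := (mdeg m).+1 in
  \sum_(p : bmultinom n d * bmultinom n d
      | mnm_add p.1 p.2 == m) a p.1 * b p.2.

Definition fps_der (i : 'I_n) (a : fps) : fps := fun m =>
  a (mnm_add m (mnm1 i)) *+ (m i).+1.

Definition formal_category : category K n :=
  @Category K n (multi_index n -> K) (fun=> True) eq fps_mul fps_der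
    (fun p m => mcoeff m p).

End FormalSeries.

Section AnalyticGerms.
Variables (K : numFieldType) (n : nat).

Definition monomial_at (x : 'rV[K]_n) (m : multi_index n) : K :=
  \prod_(i < n) x 0 i ^+ m i.

(* g is, on some polydisc around 0, the sum of an absolutely convergent power
   series; for K = C this is holomorphy near 0. *)
Definition analytic_at0 (g : 'rV[K]_n -> K) : Prop :=
  exists (a : multi_index n -> K) (r M : K),
    [/\ 0 < r,
        forall d : nat,
          \sum_(m : bmultinom n d) `|a m| * r ^+ mdeg m <= M
      & forall x : 'rV[K]_n, (forall i, `|x 0 i| < r) ->
          \sum_(m : bmultinom n d) a m * monomial_at x m
            @[d --> \oo] --> g x].

Definition analytic_category : category K n :=
  @Category K n ('rV[K]_n -> K) analytic_at0
    (fun g h => \forall x \near (0 : 'rV[K]_n), g x = h x)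
    (fun g h => g \* h)
    (fun i g x => 'D_(delta_mx 0 i) g x)
    (fun p x => meval (fun i => x 0 i) p).

End AnalyticGerms.

Section Cohomology.
Variables (K : numFieldType) (n : nat) (C : category K n).
Implicit Types (f : rep C).

(* A k-form is given by its coefficients on the basis
   dx_I = dx_(i1) /\ ... /\ dx_(ik), where I = {i1 < ... < ik}. *)
Definition coeffs : Type := {set 'I_n} -> rep C.

Definition is_form (k : nat) (w : coeffs) : Prop :=
  forall I : {set 'I_n}, if #|I| == k then germ (w I) else w I = 0.

Definition same_form (w v : coeffs) : Prop := forall I, same (w I) (v I).

(* dx_j /\ dx_(J \ j) = (-1)^(nb_below j J) dx_J for j in J *)
Definition nb_below (j : 'I_n) (J : {set 'I_n}) : nat :=
  #|[set i in J | (i < j)%N]|.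

Definition ext_der (w : coeffs) : coeffs := fun J =>
  \sum_(j in J) (-1) ^+ nb_below j J *: pder j (w (J :\ j)).

Definition dwedge f (w : coeffs) : coeffs := fun J =>
  \sum_(j in J) (-1) ^+ nb_below j J *: gmul (pder j f) (w (J :\ j)).

Definition d_f f (k : nat) (w : coeffs) : coeffs := fun J =>
  gmul f (ext_der w J) - dwedge f w J *+ k.

Definition cocycle f (k : nat) (w : coeffs) : Prop :=
  is_form k w /\ same_form (d_f f k w) (fun=> 0).

Definition coboundary f (k : nat) (w : coeffs) : Prop :=
  match k with
  | 0 => same_form w (fun=> 0)
  | k'.+1 => exists2 v, is_form k' v & same_form w (d_f f k' v)
  end.

Definition H_trivial f (k : nat) : Prop :=
  forall w, cocycle f k w -> coboundary f k w.

Definition jacobian_ideal f (g : rep C) : Prop :=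
  exists2 h : 'I_n -> rep C, forall i, germ (h i) &
    same g (\sum_(i < n) gmul (h i) (pder i f)).

(* Q_f is spanned by the classes of finitely many germs *)
Definition finite_codimension f : Prop :=
  exists (N : nat) (b : 'I_N -> rep C), (forall j, germ (b j)) /\
    forall g, germ g ->
      exists c : 'I_N -> K, jacobian_ideal f (g - \sum_(j < N) c j *: b j).

End Cohomology.

Definition quasihomogeneous (K : numFieldType) (n : nat) (p : {mpol K[n]})
    (N : nat) : Prop :=
  exists w : 'I_n -> nat, (forall i, 0 < w i)%N /\
    \sum_(i < n) (mpolyX K (mnm1 i) * mderiv i p) *+ w i
      = p *+ N.

Inductive ground := real_ground | complex_ground.

Definition ground_field (R : realType) (g : ground) : numFieldType :=
  match g with
  | real_ground => R
  | complex_ground => R[i]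
  end.

Inductive regularity := formal | analytic.

(* analytic germs over the complex ground field are the holomorphic ones *)
Definition germ_category (K : numFieldType) (n : nat) (r : regularity) :
    category K n :=
  match r with
  | formal => formal_category K n
  | analytic => analytic_category K n
  end.

(* Main.v *)
Require Import Defs.
From mathcomp Require mpoly.
Import -(notations) mpoly.
From HB Require Import structures.
From mathcomp Require Import all_boot all_order all_algebra.
From mathcomp Require Import all_classical all_reals all_analysis.
From mathcomp Require Import complex.
From mathcomp Require Import ring zify.
Set Implicit Arguments.
Unset Strict Implicit.
Unset Printing Implicit Defensive.
Import Order.TTheory GRing.Theory Num.Theory.
Import numFieldNormedType.Exports.
Local Open Scope classical_set_scope.
Local Open Scope ring_scope.

(** Why the theorem is true.

    For a k-form w, d_f w = 0 says that w / f^k is closed, and w = d_f v says that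
    w / f^k is the derivative of v / f^(k - 1): a closed form with a pole along
    f = 0 must be given a primitive of smaller pole order.  Three facts carry
    the proof.

    Division ([koszul_exact], [ext_df_exact]).  If df /\ w = 0 and w has degree
    between 1 and n - 1, then w = df /\ v.  Finite codimension forces a power
    x_i^(e_i) of each variable into the Jacobian ideal ([power_in_jacobian]), and
    these monomials form a regular sequence ([monomial_regular]); since
    multiplication by an element of the Jacobian ideal is homotopic to zero on the
    Koszul complex of the partial derivatives, the usual depth argument applies.

    Weights.  Let W be the Euler field, and give dx_i the weight w_i of x_i.
    The Lie derivative d i_W + i_W d multiplies a form of weight t by t, while
    multiplication by f and by df shift the weight by N.  A form of positive
    degree has no part of weight 0.

    Pole reduction ([pole_order_exact]).  Split a cocycle w of degree k into its
    part of weight kN and the rest.  Off the weight kN, w / f^k is the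
    derivative of the contraction of a multiple of w with W, divided by f^k;
    two divisions by df lower the pole order of this primitive to k - 1
    ([coboundary_nonresonant]).  In weight kN, division gives
    w = f b + df /\ c; modulo a coboundary w is f times a cocycle of pole order
    k - 1 and weight (k - 1)N, and the descent ends at pole order 1, where b and c
    have weight 0 and positive degree, hence vanish ([coboundary_resonant]).

    All of this takes place in a space of formal power series that is closed
    under products, derivatives, shifts of exponents and, above all, under any
    decrease of the absolute values of the coefficients ([admissible]): this
    is why weight components, division by nonzero integers and division by
    monomials stay inside the space.  Both all power series and the
    convergent ones qualify.  Analytic germs are then exchanged for their
    Taylor series ([realization_analytic]), which requires termwise
    differentiation, Cauchy products, and completeness of the ground field. *)

(** * Exterior multiplication and contraction *)

Section Exterior.
Variables (K : numFieldType) (V : lmodType K) (n : nat).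
Implicit Types (w : {set 'I_n} -> V) (J : {set 'I_n}) (j k : 'I_n).

(** With [P j] the partial derivative of index j this is the exterior
    derivative; with [P j] the multiplication by the partial derivative of f it
    is the exterior product by df. *)
Definition ext (P : 'I_n -> {linear V -> V}) w : {set 'I_n} -> V := fun J =>
  \sum_(j in J) (-1) ^+ nb_below j J *: P j (w (J :\ j)).

(** With [Q j] the multiplication by the component a_j of a vector field, this
    is the interior product by that field. *)
Definition contr (Q : 'I_n -> {linear V -> V}) w : {set 'I_n} -> V := fun J =>
  \sum_(j | j \notin J) (-1) ^+ nb_below j J *: Q j (w (j |: J)).

Lemma ext_is_linear P : linear (ext P).
Proof.
move=> c u v; apply/funext => J; rewrite /ext !fctE scaler_sumr -big_split /=.
by apply: eq_bigr => j _; rewrite linearP scalerDr !scalerA mulrC.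
Qed.
HB.instance Definition _ P :=
  GRing.isLinear.Build K ({set 'I_n} -> V) ({set 'I_n} -> V) *:%R (ext P)
    (ext_is_linear P).

Lemma contr_is_linear Q : linear (contr Q).
Proof.
move=> c u v; apply/funext => J; rewrite /contr !fctE scaler_sumr -big_split /=.
by apply: eq_bigr => j _; rewrite linearP scalerDr !scalerA mulrC.
Qed.
HB.instance Definition _ Q :=
  GRing.isLinear.Build K ({set 'I_n} -> V) ({set 'I_n} -> V) *:%R (contr Q)
    (contr_is_linear Q).

Lemma nb_belowD1 j k J : k \in J ->
  nb_below j J = ((k < j)%N + nb_below j (J :\ k))%N.
Proof.
move=> kJ; rewrite /nb_below (cardsD1 k) !inE kJ /=; congr (_ + _)%N.
by apply: eq_card => i; rewrite !inE andbA.
Qed.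

Lemma nb_belowU1 j k J : k \notin J ->
  nb_below j (k |: J) = ((k < j)%N + nb_below j J)%N.
Proof. by move=> kJ; rewrite (nb_belowD1 j (finset.setU11 k J)) finset.setU1K. Qed.

Lemma sign_swap j k : j != k -> (-1) ^+ (j < k)%N = - (-1) ^+ (k < j)%N :> K.
Proof. by rewrite neq_ltn => /orP[] h; rewrite h ltnNge ltnW //= ?expr0 ?expr1 ?opprK. Qed.

Lemma ext_ext P P' w J : ext P (ext P' w) J =
  \sum_(j in J) \sum_(k in J | k != j)
    ((-1) ^+ nb_below j J * (-1) ^+ nb_below k (J :\ j))
      *: P j (P' k (w (J :\ j :\ k))).
Proof.
apply: eq_bigr => j _; rewrite /ext linear_sum scaler_sumr.
apply: eq_big => [k|k _]; first by rewrite !inE andbC.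
by rewrite linearZ scalerA.
Qed.

(** Removing two indices from J in either order gives the same coefficient of
    the form and opposite signs, so a symmetric expression equals its own
    opposite.  A sum of two terms is needed for d (df /\ w) + df /\ dw, which is
    symmetric although neither term is. *)
Lemma ext_ext_antisym (P1 P2 Q1 Q2 : 'I_n -> {linear V -> V}) w :
  (forall j k a, P1 j (P2 k a) + Q1 j (Q2 k a) =
                 P1 k (P2 j a) + Q1 k (Q2 j a)) ->
  ext P1 (ext P2 w) + ext Q1 (ext Q2 w) = 0.
Proof.
move=> sym; apply/funext => J.
set S := (X in X J).
suff SN : S J = - S J.
  have /eqP : S J + S J = 0 by rewrite {1}SN addNr.
  by rewrite -mulr2n -scaler_nat scaler_eq0 pnatr_eq0 /= => /eqP.
rewrite /S !fctE !ext_ext -big_split /=.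
under [LHS]eq_bigr do rewrite -big_split /=.
rewrite (exchange_big_dep (mem J)) /=; last by move=> j k _ /andP[].
rewrite -sumrN; apply: eq_bigr => k kJ.
rewrite -big_split /= -sumrN; apply: eq_big => [j|j].
  by rewrite kJ /= eq_sym.
move=> /andP[jJ /andP[_ kj]].
rewrite -!scalerDr sym !finset.setDDl (finset.setUC [set j]) -scaleNr; congr (_ *: _).
rewrite (nb_belowD1 j kJ) (nb_belowD1 k jJ) !exprD (sign_swap kj).
move: ((-1) ^+ _) ((-1) ^+ _) ((-1) ^+ _) => a b c; ring.
Qed.

Lemma ext_ext_sym (P1 P2 : 'I_n -> {linear V -> V}) w :
  (forall j k a, P1 j (P2 k a) = P1 k (P2 j a)) -> ext P1 (ext P2 w) = 0.
Proof.
move=> sym; have /eqP := @ext_ext_antisym P1 P2 P1 P2 w (fun j k a =>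
  congr2 +%R (sym j k a) (sym j k a)).
by rewrite -mulr2n -scaler_nat scaler_eq0 pnatr_eq0 /= => /eqP.
Qed.

(** The terms in which the inserted and the removed index differ cancel in
    pairs, because the two orders carry opposite signs.  This single identity gives
    the homotopy on the Koszul complex and the formula of Cartan for the Lie
    derivative along the Euler field. *)
Lemma cartan (P Q : 'I_n -> {linear V -> V}) w J :
  (forall j k a, j != k -> P j (Q k a) = Q k (P j a)) ->
  ext P (contr Q w) J + contr Q (ext P w) J =
  \sum_j (if j \in J then P j (Q j (w J)) else Q j (P j (w J))).
Proof.
move=> PQ; rewrite (bigID (mem J)) /=.
have -> : ext P (contr Q w) J = \sum_(j in J) P j (Q j (w J)) +
   \sum_(j in J) \sum_(k | k \notin J)
     ((-1) ^+ nb_below j J * (-1) ^+ nb_below k (J :\ j))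
     *: P j (Q k (w (k |: J :\ j))).
  rewrite -big_split /=; apply: eq_bigr => j jJ.
  rewrite /contr linear_sum scaler_sumr (bigD1 j) /= ?finset.setD11 //.
  rewrite linearZ scalerA finset.setD1K // (nb_belowD1 j jJ) ltnn add0n -expr2 sqrr_sign.
  rewrite scale1r; congr (_ + _); apply: eq_big => [k|k _]; last first.
    by rewrite linearZ scalerA.
  rewrite !inE negb_and negbK; case: eqP => [->|_] //=; last by rewrite andbT.
  by rewrite jJ.
have -> : contr Q (ext P w) J = \sum_(k | k \notin J) Q k (P k (w J)) +
   \sum_(k | k \notin J) \sum_(j in J)
     ((-1) ^+ nb_below k J * (-1) ^+ nb_below j (k |: J))
     *: Q k (P j (w (k |: J :\ j))).
  rewrite -big_split /=; apply: eq_bigr => k kJ.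
  rewrite /ext linear_sum scaler_sumr (bigD1 k) /= ?finset.setU11 //.
  rewrite linearZ scalerA finset.setU1K // (nb_belowU1 k kJ) ltnn add0n -expr2 sqrr_sign.
  rewrite scale1r; congr (_ + _); apply: eq_big => [j|j].
    rewrite !inE; case: eqP => [->|_] //=; last by rewrite andbT.
    by rewrite (negbTE kJ).
  rewrite linearZ scalerA => /andP[_ jk]; congr (_ *: Q k (P j (w _))).
  by apply/setP => i; rewrite !inE; case: (eqVneq i k) => [->|] //=; rewrite eq_sym jk.
rewrite addrACA [X in _ + X](_ : _ = 0) ?addr0; last first.
  rewrite [X in _ + X]exchange_big -big_split /= big1 // => j jJ.
  rewrite -big_split big1 //= => k kJ.
  have jk : j != k by apply: contraNneq kJ => <-.
  rewrite PQ // -scalerDl (nb_belowD1 k jJ) (nb_belowU1 j kJ) !exprD.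
  rewrite (sign_swap jk); apply/eqP; rewrite scaler_eq0; apply/orP; left.
  apply/eqP; have := @sqrr_sign K (k < j)%N.
  move: ((-1) ^+ nb_below j J) ((-1) ^+ nb_below k (J :\ j)) ((-1) ^+ (k < j)%N).
  by move=> a b c c2; rewrite (_ : _ + _ = a * b * (1 - c ^+ 2)); [rewrite c2; ring | ring].
by congr (_ + _); apply: eq_bigr => j; [move=> ->|move=> /negbTE ->].
Qed.

End Exterior.

(** * Depth and exactness of the Koszul complex *)

(** The operators [phi j] and [h i j] stand for multiplications by elements of a
    ring acting on a module, of which [S] is a submodule; [hphi i] is then
    multiplication by an element of the ideal generated by the [phi j].  Only the
    commutation of the operators matters. *)
Section KoszulDepth.
Variables (K : numFieldType) (V : lmodType K) (n : nat) (S : V -> Prop).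
Variables (phi : 'I_n -> {linear V -> V}) (h : 'I_n -> 'I_n -> {linear V -> V}).

Hypothesis S0 : S 0.
Hypothesis S_linear : forall c x y, S x -> S y -> S (c *: x + y).
Hypothesis S_phi : forall j x, S x -> S (phi j x).
Hypothesis S_h : forall i j x, S x -> S (h i j x).
Hypothesis phi_phiC : forall i j x, phi i (phi j x) = phi j (phi i x).
Hypothesis phi_hC : forall i j k x, phi k (h i j x) = h i j (phi k x).
Hypothesis h_hC : forall i j k l x, h i j (h k l x) = h k l (h i j x).

Definition hphi (i : 'I_n) (x : V) : V := \sum_j h i j (phi j x).

Lemma hphi_is_linear i : linear (hphi i).
Proof.
move=> c x y; rewrite /hphi scaler_sumr -big_split /=.
by apply: eq_bigr => j _; rewrite !linearP.
Qed.
HB.instance Definition _ i :=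
  GRing.isLinear.Build K V V *:%R (hphi i) (hphi_is_linear i).

Definition in_ideal (r : nat) (x : V) : Prop :=
  exists2 t : 'I_n -> V, forall i, S (t i) &
    x = \sum_(i < n | (i < r)%N) hphi i (t i).

Hypothesis hphi_regular : forall (r : 'I_n) x,
  S x -> in_ideal r (hphi r x) -> in_ideal r x.

Let SZ c x : S x -> S (c *: x).
Proof. by move=> Sx; rewrite -[c *: x]addr0; apply: S_linear. Qed.
Let SD x y : S x -> S y -> S (x + y).
Proof. by move=> Sx Sy; rewrite -[x]scale1r; apply: S_linear. Qed.
Let SB x y : S x -> S y -> S (x - y).
Proof. by move=> Sx Sy; rewrite -scaleN1r addrC; apply: S_linear. Qed.
Let S_sum (I : finType) (P : pred I) (F : I -> V) :
  (forall i, P i -> S (F i)) -> S (\sum_(i | P i) F i).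
Proof. by move=> SF; apply: big_ind => //; apply: SD. Qed.

Let S_ext w : (forall J, S (w J)) -> forall J, S (ext phi w J).
Proof. by move=> Sw J; apply: S_sum => j _; apply/SZ/S_phi. Qed.

Let S_contr i w : (forall J, S (w J)) -> forall J, S (contr (h i) w J).
Proof. by move=> Sw J; apply: S_sum => j _; apply/SZ/S_h. Qed.

Let phi_hphi k i x : phi k (hphi i x) = hphi i (phi k x).
Proof. by rewrite linear_sum; apply: eq_bigr => j _; rewrite phi_hC phi_phiC. Qed.

Let h_hphi k l i x : h k l (hphi i x) = hphi i (h k l x).
Proof. by rewrite linear_sum; apply: eq_bigr => j _; rewrite h_hC phi_hC. Qed.

Let in_ideal0 r : in_ideal r 0.
Proof. by exists (fun=> 0) => //; rewrite big1 // => i _; rewrite linear0. Qed.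

Let in_idealP r c x y : in_ideal r x -> in_ideal r y -> in_ideal r (c *: x + y).
Proof.
move=> [t St ->] [u Su ->]; exists (fun i => c *: t i + u i).
  by move=> i; apply: S_linear.
rewrite scaler_sumr -big_split /=; apply: eq_bigr => i _.
by rewrite linearP.
Qed.

Let in_idealZ r c x : in_ideal r x -> in_ideal r (c *: x).
Proof. by move=> Ix; rewrite -[c *: x]addr0; apply: in_idealP. Qed.
Let in_idealD r x y : in_ideal r x -> in_ideal r y -> in_ideal r (x + y).
Proof. by move=> Ix Iy; rewrite -[x]scale1r; apply: in_idealP. Qed.
Let in_ideal_sum r (I : finType) (P : pred I) (F : I -> V) :
  (forall i, P i -> in_ideal r (F i)) -> in_ideal r (\sum_(i | P i) F i).
Proof. by move=> SF; apply: big_ind => //; apply: in_idealD. Qed.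

Let in_ideal_phi r k x : in_ideal r x -> in_ideal r (phi k x).
Proof.
move=> [t St ->]; exists (fun i => phi k (t i)) => [i|]; first exact: S_phi.
by rewrite linear_sum; apply: eq_bigr => i _; rewrite phi_hphi.
Qed.

Let in_ideal_h r k l x : in_ideal r x -> in_ideal r (h k l x).
Proof.
move=> [t St ->]; exists (fun i => h k l (t i)) => [i|]; first exact: S_h.
by rewrite linear_sum; apply: eq_bigr => i _; rewrite h_hphi.
Qed.

Let in_ideal_ext r w : (forall J, in_ideal r (w J)) ->
  forall J, in_ideal r (ext phi w J).
Proof. by move=> Iw J; apply: in_ideal_sum => j _; apply/in_idealZ/in_ideal_phi. Qed.

Let in_ideal_contr r i w : (forall J, in_ideal r (w J)) ->
  forall J, in_ideal r (contr (h i) w J).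
Proof. by move=> Iw J; apply: in_ideal_sum => j _; apply/in_idealZ/in_ideal_h. Qed.

Let in_idealS (r : 'I_n) x : in_ideal r.+1 x <->
  exists2 t, S t & in_ideal r (x - hphi r t).
Proof.
have E (t : 'I_n -> V) : \sum_(i < n | (i < r.+1)%N) hphi i (t i) =
    hphi r (t r) + \sum_(i < n | (i < r)%N) hphi i (t i).
  rewrite (bigD1 r) //=; congr (_ + _); apply: eq_bigl => i.
  by rewrite ltnS [RHS]ltn_neqAle andbC.
split=> [[t St ->]|[t St [u Su ux]]].
  by exists (t r) => //; exists t => //; rewrite E addrC addKr.
exists (fun i => if i == r then t else u i); first by move=> i; case: ifP.
rewrite E eqxx -[x](subrK (hphi r t)) ux addrC; congr (_ + _).
by apply: eq_bigr => i ir; case: eqP => // irE; rewrite irE ltnn in ir.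
Qed.

Let ext_hphi r w : ext phi (fun J => hphi r (w J)) = fun J => hphi r (ext phi w J).
Proof.
apply/funext => J; rewrite /ext linear_sum; apply: eq_bigr => j _.
by rewrite linearZ /= phi_hphi.
Qed.

(** Multiplication by an element of the ideal is homotopic to zero. *)
Let homotopy r w J :
  ext phi (contr (h r) w) J + contr (h r) (ext phi w) J = hphi r (w J).
Proof.
rewrite cartan => [|j k x _]; last exact: phi_hC.
by apply: eq_bigr => j _; case: ifP => // _; rewrite phi_hC.
Qed.

Let ext_phi_phi w : ext phi (ext phi w) = 0.
Proof. exact: ext_ext_sym. Qed.

(** Induction step of the depth argument.  By the homotopy, the r-th element of
    the sequence times w equals d (i w) modulo the first r elements, d being
    [ext phi] and i the contraction; writing i w as d eta plus that r-th element
    times tau, and using d d = 0, the element can be cancelled from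
    w - d tau by regularity. *)
Let in_ideal_lift (r : 'I_n) (w eta tau : {set 'I_n} -> V) :
  (forall J, S (w J)) -> (forall J, S (tau J)) ->
  (forall J, in_ideal r (ext phi w J)) ->
  (forall J, in_ideal r (contr (h r) w J - ext phi eta J - hphi r (tau J))) ->
  forall J, in_ideal r (w J - ext phi tau J).
Proof.
move=> Sw Stau Iw It J; apply: hphi_regular; first exact/SB/S_ext.
rewrite linearB /= -homotopy -[hphi r _](congr1 (@^~ J) (ext_hphi r tau)).
rewrite addrAC; apply: in_idealD; last exact: in_ideal_contr.
suff -> : ext phi (contr (h r) w) J - ext phi (fun J => hphi r (tau J)) J
   = ext phi (contr (h r) w - ext phi eta - (fun J => hphi r (tau J))) J.
  exact: in_ideal_ext.
by rewrite !linearB /= ext_phi_phi subr0.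
Qed.

(** Depth sensitivity of the Koszul complex without quotient modules: exactness
    in degree k modulo the first r elements follows from exactness in degree
    k - 1 modulo the first r + 1 elements, so that k + r stays below the length n
    of the sequence.  In degree 0 the contraction vanishes. *)
Lemma koszul_exact_mod (r k : nat) (w : {set 'I_n} -> V) :
  (k + r < n)%N -> (forall J, S (w J)) ->
  (forall J : {set 'I_n}, #|J| != k -> w J = 0) ->
  (forall J, in_ideal r (ext phi w J)) ->
  exists2 eta, forall J, S (eta J) & forall J, in_ideal r (w J - ext phi eta J).
Proof.
elim: k r w => [|k IHk] r w krn Sw wk Iw;
  have rn : (r < n)%N by rewrite (leq_trans _ krn) // ltnS leq_addl.
- exists 0 => // J; apply: (@in_ideal_lift (Ordinal rn) w 0 0) => //= {}J.
  rewrite linear0 subr0 linear0 subr0 /contr big1 // => j jJ.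
  by rewrite wk ?linear0 ?scaler0 // cardsU1 jJ.
- have [||||eta Seta] := IHk r.+1 (contr (h (Ordinal rn)) w).
  + by rewrite addnS -addSn.
  + exact: S_contr.
  + move=> J Jk; rewrite /contr big1 // => j jJ; rewrite wk ?linear0 ?scaler0 //.
    by rewrite cardsU1 jJ.
  + move=> J; apply/(in_idealS (Ordinal rn)); exists (w J) => //=.
    by rewrite -homotopy opprD addNKr -scaleN1r; apply/in_idealZ/in_ideal_contr.
  + move=> H; have {H} /choice[tau H] : forall J : {set 'I_n}, exists t, S t /\
      in_ideal r (contr (h (Ordinal rn)) w J - ext phi eta J
                  - hphi (Ordinal rn) t).
      by move=> J; have /(in_idealS (Ordinal rn))[t ? ?] := H J; exists t.
    exists tau => [J|]; first by have [] := H J.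
    by apply: (@in_ideal_lift (Ordinal rn) w eta tau) => // J; have [] := H J.
Qed.

Theorem koszul_exact (k : nat) (w : {set 'I_n} -> V) :
  (k.+1 < n)%N -> (forall J, S (w J)) ->
  (forall J : {set 'I_n}, #|J| != k.+1 -> w J = 0) ->
  ext phi w = 0 ->
  exists eta, [/\ forall J, S (eta J), forall J : {set 'I_n}, #|J| != k -> eta J = 0
    & w = ext phi eta].
Proof.
move=> kn Sw wk w0; have [||eta Seta Ieta] := koszul_exact_mod (r := 0) _ Sw wk.
- by rewrite addn0.
- by move=> J; rewrite w0.
(* only the component of degree k of the primitive contributes *)
exists (fun J : {set 'I_n} => if #|J| == k then eta J else 0); split.
- by move=> J; case: ifP.
- by move=> J /negbTE ->.
- apply/funext => J; have [t _] := Ieta J; rewrite big_pred0_eq => /subr0_eq wE.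
  have [Jk|Jk] := eqVneq #|J| k.+1.
    rewrite wE; apply: eq_bigr => j jJ.
    by move: Jk; rewrite (cardsD1 j) jJ add1n => -[->]; rewrite eqxx.
  rewrite wk // /ext big1 // => j jJ; case: ifP => [/eqP kE|]; last first.
    by rewrite linear0 scaler0.
  by move: Jk; rewrite (cardsD1 j) jJ kE eqxx.
Qed.

End KoszulDepth.

(** * Reduction of the pole order *)

Lemma mulrn_inj (K : numFieldType) (V : lmodType K) (k : nat) :
  injective (fun x : V => x *+ k.+1).
Proof.
move=> x y /eqP; rewrite -subr_eq0 -mulrnBl -scaler_nat scaler_eq0 pnatr_eq0 /=.
by rewrite subr_eq0 => /eqP.
Qed.

(** The algebra behind the theorem uses nothing but the operators on forms: [F]
    is multiplication by f, [de] the exterior product by df, [d] the exterior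
    derivative, [io] the contraction with the Euler field, and [T g] multiplies
    the part of weight t by g t; [Form k] says that a form has degree k and
    coefficients in the chosen category. *)
Section PoleReduction.
Variables (K : numFieldType) (Om : lmodType K) (n N : nat).
Variables (F de d io : {linear Om -> Om}) (T : (nat -> K) -> {linear Om -> Om}).
Variable Form : nat -> Om -> Prop.

Hypothesis F_inj : forall x, F x = 0 -> x = 0.
Hypothesis de_de : forall x, de (de x) = 0.
Hypothesis d_d : forall x, d (d x) = 0.
Hypothesis d_de : forall x, d (de x) = - de (d x).
Hypothesis de_F : forall x, de (F x) = F (de x).
Hypothesis d_F : forall x, d (F x) = de x + F (d x).
Hypothesis io_F : forall x, io (F x) = F (io x).
Hypothesis io_de : forall x, io (de x) + de (io x) = F x *+ N.
(* the Lie derivative along the Euler field is the weight *)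
Hypothesis io_d : forall x, io (d x) + d (io x) = T (fun t => t%:R) x.
Hypothesis T_T : forall a b x, T a (T b x) = T (fun t => a t * b t) x.
Hypothesis T_linear : forall c a b x,
  T (fun t => c * a t + b t) x = c *: T a x + T b x.
Hypothesis T1 : forall x, T (fun=> 1) x = x.
Hypothesis T_d : forall a x, d (T a x) = T a (d x).
Hypothesis T_de : forall a x, de (T (fun t => a (t + N)%N) x) = T a (de x).
Hypothesis T_F : forall a x, F (T (fun t => a (t + N)%N) x) = T a (F x).
Hypothesis Form0 : forall k, Form k 0.
Hypothesis Form_linear : forall k c x y,
  Form k x -> Form k y -> Form k (c *: x + y).
Hypothesis Form_F : forall k x, Form k x -> Form k (F x).
Hypothesis Form_d : forall k x, Form k x -> Form k.+1 (d x).
Hypothesis Form_io : forall k x, Form k.+1 x -> Form k (io x).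
Hypothesis Form_T : forall k a x, (forall t, `|a t| <= 1) ->
  Form k x -> Form k (T a x).
Hypothesis Form_weight0 : forall k x, Form k.+1 x ->
  T (fun t => (t == 0)%N%:R) x = 0.
Hypothesis de_exact : forall k x, (k.+1 < n)%N -> Form k.+1 x -> de x = 0 ->
  exists2 y, Form k y & x = de y.

Let FormZ k c x : Form k x -> Form k (c *: x).
Proof. by move=> Fx; rewrite -[c *: x]addr0; apply: Form_linear. Qed.
Let FormD k x y : Form k x -> Form k y -> Form k (x + y).
Proof. by move=> Fx Fy; rewrite -[x]scale1r; apply: Form_linear. Qed.
Let FormB k x y : Form k x -> Form k y -> Form k (x - y).
Proof. by move=> Fx Fy; rewrite -scaleN1r addrC; apply: Form_linear. Qed.

Let de_exact_nat k m x : (k.+1 < n)%N -> Form k.+1 x -> de x = 0 ->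
  exists2 y, Form k y & x = de y *+ m.+1.
Proof.
move=> kn Fx dx; have [||y Fy yx] := de_exact kn (x := m.+1%:R^-1 *: x).
- exact: FormZ.
- by rewrite linearZ /= dx scaler0.
by exists y => //; rewrite -yx -scaler_nat scalerA divff ?scale1r // pnatr_eq0.
Qed.

Let T_ext a b x : a =1 b -> T a x = T b x.
Proof. by move=> ab; congr (T _ x); apply/funext. Qed.

Definition proj (s : nat) : {linear Om -> Om} := T (fun t => (t == s)%:R).

Let Form_proj k s x : Form k x -> Form k (proj s x).
Proof. by apply: Form_T => t; case: eqP => _; rewrite ?normr1 ?normr0. Qed.

Let proj_shift (G : {linear Om -> Om}) s x :
  (forall a x, G (T (fun t => a (t + N)%N) x) = T a (G x)) ->
  proj (s + N) (G x) = G (proj s x).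
Proof. by move=> GT; rewrite -GT; congr (G _); apply: T_ext => t; rewrite eqn_add2r. Qed.

Let proj_proj s x : proj s (proj s x) = proj s x.
Proof. by rewrite T_T; apply: T_ext => t; case: eqP; rewrite (mulr1,mulr0). Qed.

(** [cocycle_at p x] says that x / f^p is closed, and [coboundary_at p k x] that
    x / f^(p + 1) is the derivative of y / f^p for some form y of degree k. *)
Definition cocycle_at p x := F (d x) = de x *+ p.
Definition coboundary_at p k x :=
  exists2 y, Form k y & x = F (d y) - de y *+ p.

(** Induction on the pole order.  The product of the cocycle condition with df
    gives df /\ dx = 0, hence dx = p.+1 df /\ y and x = F y + df /\ z.  Subtracting the
    coboundary of a multiple of z leaves [F (y + d z)], where [y + d z] is a
    cocycle for the next smaller pole order, of weight lowered by N.  At pole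
    order 1 the weights of y and z are 0, and their degrees are positive. *)
Lemma coboundary_resonant p q x : (q.+3 < n)%N -> Form q.+2 x ->
  proj (p.+1 * N) x = x -> cocycle_at p.+1 x -> coboundary_at p q.+1 x.
Proof.
move=> qn; elim: p x => [|p IHp] x Fx px cx.
all: have dedx : de (d x) = 0
  by apply: F_inj; rewrite -de_F cx linearMn /= de_de mul0rn.
- rewrite mul1n in px.
  have [y0 Fy0 dxy] := de_exact qn (Form_d Fx) dedx.
  have py : proj 0 y0 = 0 by apply: Form_weight0 Fy0.
  have dx0 : d x = 0.
    by rewrite -px T_d dxy -[N]add0n proj_shift // py linear0.
  have dex : de x = 0 by move: cx; rewrite /cocycle_at dx0 linear0 mulr1n.
  have [y1 Fy1 xy] := de_exact (ltnW qn) Fx dex.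
  have py1 : proj 0 y1 = 0 by apply: Form_weight0 Fy1.
  exists 0; first exact: Form0.
  rewrite !linear0 ?mul0rn ?subr0.
  by rewrite -px xy -[N]add0n proj_shift // py1 linear0 addr0.
- have [y0 Fy0 dxy0] := de_exact_nat p.+1 qn (Form_d Fx) dedx.
  pose y := proj (p.+1 * N) y0.
  have Fy : Form q.+2 y by apply: Form_proj.
  have dxy : d x = de y *+ p.+2.
    rewrite -px T_d dxy0 mulSn addnC linearMn; congr (_ *+ _).
    exact: proj_shift.
  have [|z0 Fz0 xz0] := de_exact_nat p (ltnW qn) (FormB Fx (Form_F Fy)).
    rewrite linearB /= de_F; apply/eqP; rewrite subr_eq0; apply/eqP.
    by apply: (@mulrn_inj _ _ p.+1); rewrite -cx dxy linearMn.
  pose z := proj (p.+1 * N) z0.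
  have Fz : Form q.+1 z by apply: Form_proj.
  have xz : x = F y + de z *+ p.+1.
    apply/eqP; rewrite addrC -subr_eq; apply/eqP.
    have E : proj (p.+2 * N) (x - F y) = x - F y.
      rewrite linearB /= px; congr (_ - _).
      by rewrite mulSn addnC proj_shift // proj_proj.
    by rewrite -E xz0 mulSn addnC linearMn /= proj_shift.
  have Fdy : F (d y) = (de y + de (d z)) *+ p.+1.
    have := dxy; rewrite {1}xz linearD /= d_F linearMn /= d_de mulNrn mulrS.
    rewrite -addrA => /addrI /eqP; rewrite subr_eq => /eqP ->.
    by rewrite mulrnDl.
  have [|||e Fe ye] := IHp (y + d z).
  + exact/FormD/Form_d.
  + rewrite linearD -[proj _ (d z)]T_d; congr (_ + d _); exact: proj_proj.
  + by rewrite /cocycle_at !linearD /= d_d linear0 addr0 Fdy.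
  exists (F e - z); first exact/FormB/Fz/Form_F.
  rewrite !linearB /= d_F linearD /= de_F.
  have -> : x = F (y + d z) - F (d z) + de z *+ p.+1.
    by rewrite [F (y + _)]linearD /= addrK.
  rewrite ye linearB linearMn /= mulrnBl [X in X - de z *+ _]mulrS.
  rewrite opprB opprD !addrA.
  by rewrite [RHS](ACl (1*5*2*6*3*4))/= subrr add0r.
Qed.

(** Let x' be x divided, weight by weight, by t - (k N) for k = q.+2.  The formula
    of Cartan applied to the closed form x' / f^k exhibits x / f^k as the derivative
    of th / f^k, with th the contraction of x' (this is [Fxth]).  The pole of
    this primitive has order k instead of k - 1; since F divides df /\ th, one
    division gives df /\ (th - F xi) = 0, a second one th = F xi + df /\ ze, and
    the term df /\ ze / f^k is, up to an exact form, d ze / f^(k - 1). *)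
Lemma coboundary_nonresonant q x : (q.+2 < n)%N -> Form q.+2 x ->
  proj (q.+2 * N) x = 0 -> cocycle_at q.+2 x -> coboundary_at q.+1 q.+1 x.
Proof.
move=> qn Fx px cx; set s := (q.+2 * N)%N.
pose c (t : nat) : K := if t == s then 0 else (t%:R - s%:R)^-1.
have c_le1 t : `|c t| <= 1.
  rewrite /c; case: eqVneq => [_|ts]; first by rewrite normr0.
  rewrite normfV invf_le1; last by rewrite normr_gt0 subr_eq0 eqr_nat.
  case: (ltngtP t s) ts => // [ts|ts] _.
    by rewrite distrC -natrB ?(ltnW ts) // normr_nat ler1n subn_gt0.
  by rewrite -natrB ?(ltnW ts) // normr_nat ler1n subn_gt0.
pose x' := T c x.
have Fx' : Form q.+2 x' by apply: Form_T.
have Lx' : T (fun t => t%:R) x' - x' *+ s = x.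
  have -> : T (fun t => t%:R) x' - x' *+ s = T (fun t => - s%:R * 1 + t%:R) x'.
    by rewrite (T_linear _ (fun=> 1)) T1 scaleNr scaler_nat addrC.
  rewrite [RHS](_ : x = T (fun t => -1 * (t == s)%:R + 1) x); last first.
    by rewrite T_linear T1 px scaler0 add0r.
  rewrite T_T.
  apply: T_ext => t; rewrite /c; case: eqVneq => [->|ts] /=; first by ring.
  by rewrite mulr1 mulr0 add0r addrC divff // subr_eq0 eqr_nat.
have cx' : cocycle_at q.+2 x'.
  rewrite /cocycle_at T_d.
  (* the multiplier seen after the shift of weights by N *)
  have cE : forall y, T c y = T (fun t => c ((t + N) - N)%N) y.
    by move=> y; apply: T_ext => t; rewrite addnK.
  rewrite cE (T_F (fun t => c (t - N)%N)) cx linearMn /=.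
  by rewrite -(T_de (fun t => c (t - N)%N)) -cE.
have Fth := Form_io Fx'; set th := io x' in Fth.
have Fxth : F x = F (d th) - de th *+ q.+2.
  have := congr1 io cx'; rewrite io_F linearMn /=.
  have -> : io (d x') = T (fun t => t%:R) x' - d th by rewrite -io_d addrK.
  have -> : io (de x') = F x' *+ N - de th by rewrite -io_de addrK.
  rewrite mulrnBl -mulrnA [(N * _)%N]mulnC -/s linearB /= => /eqP.
  rewrite subr_eq => /eqP E; rewrite -Lx' linearB linearMn /= E.
  by rewrite [LHS](ACl (1*4*3*2))/= subrr add0r.
have [|xi Fxi xixE] := de_exact_nat q.+1 qn (FormB (Form_d Fth) Fx).
  apply: F_inj; rewrite -de_F linearB /= Fxth subKr linearMn /= de_de.
  exact: mul0rn.
have [|ze Fze zeE] := de_exact_nat q (ltnW qn) (FormB Fth (Form_F Fxi)).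
  rewrite linearB /= de_F; apply/eqP; rewrite subr_eq0; apply/eqP.
  apply: (@mulrn_inj _ _ q.+1); rewrite -[RHS]linearMn /= -xixE linearB /= Fxth.
  by rewrite subKr.
exists (xi + d ze); first exact/FormD/Form_d.
have -> : x = d th - de xi *+ q.+2 by rewrite -xixE subKr.
have -> : d th = d (de ze) *+ q.+1 + d (F xi).
  by rewrite -[th](subrK (F xi)) linearD /= zeE linearMn.
rewrite d_de d_F [de xi *+ q.+2]mulrS ![_ (xi + _)]linearD d_d addr0.
rewrite mulrnDl mulNrn.
rewrite !opprD !addrA.
by rewrite [LHS](ACl (2*4*3*5*1))/= subrr add0r.
Qed.

Theorem pole_order_exact q x : (q.+3 < n)%N -> Form q.+2 x ->
  cocycle_at q.+2 x -> coboundary_at q.+1 q.+1 x.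
Proof.
move=> qn Fx cx; set s := (q.+2 * N)%N.
have Fpx : Form q.+2 (proj s x) by apply: Form_proj.
have cpx : cocycle_at q.+2 (proj s x).
  have -> : cocycle_at q.+2 (proj s x) =
      (F (proj s (d x)) = de (proj s x) *+ q.+2) by rewrite /cocycle_at T_d.
  by rewrite -proj_shift // -proj_shift // cx linearMn.
have [y Fy yE] := coboundary_resonant (p := q.+1) qn Fpx (proj_proj s x) cpx.
have [||||z Fz zE] := @coboundary_nonresonant q (x - proj s x).
- exact: ltnW.
- exact: FormB.
- by rewrite linearB /= proj_proj subrr.
- by rewrite /cocycle_at !linearB /= cx cpx mulrnBl.
exists (y + z); first exact: FormD.
rewrite !linearD /= mulrnDl opprD addrACA -yE -zE.
by rewrite addrC subrK.
Qed.
End PoleReduction.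

(** * Algebra of formal power series *)

Section FormalAlgebra.
Variables (K : numFieldType) (n : nat).
Local Notation series := (multi_index n -> K).
Implicit Types (a b c : series) (p q : mpoly n K) (m e : multi_index n).

Definition poly_series p : series := fun m => mcoeff m p.

Definition trunc (d : nat) a : mpoly n K :=
  \sum_(m : bmultinom n d) a m *: mpolyX K m.

Lemma mcoeff_trunc d a m :
  mcoeff m (trunc d a) = if (mdeg m < d)%N then a m else 0.
Proof.
case: ifP => [md|/negbT md]; first exact: mcoeff_mpoly.
rewrite raddf_sum big1 // => i _ /=; rewrite mcoeffZ mcoeffX.
case: eqP => [im|_]; last by rewrite mulr0.
by move: (valP i); rewrite /= im (negbTE md).
Qed.

(** Identities between power series are read off, degree by degree, from the
    corresponding identities between polynomials. *)
Definition agree (d : nat) a p := forall m, (mdeg m < d)%N -> a m = mcoeff m p.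

Lemma agree_trunc d a : agree d a (trunc d a).
Proof. by move=> m md; rewrite mcoeff_trunc md. Qed.

Lemma agreeW d1 d2 a p : (d1 <= d2)%N -> agree d2 a p -> agree d1 a p.
Proof. by move=> d12 ap m md; apply/ap/(leq_trans md). Qed.

Lemma agree_mul d a b p q :
  agree d a p -> agree d b q -> agree d (fps_mul a b) (p * q).
Proof.
move=> ap bq m md; rewrite mcoeffM /fps_mul.
apply: eq_big => [k|k /eqP km]; first by rewrite eq_sym.
have : (mdeg k.1 + mdeg k.2 < d)%N by rewrite -mdegD km.
move=> kd; rewrite ap ?bq //; apply: leq_ltn_trans kd.
  exact: leq_addl.
exact: leq_addr.
Qed.

Lemma agree_der d i a p : agree d.+1 a p -> agree d (fps_der i a) (mderiv i p).
Proof.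
by move=> ap m md; rewrite mcoeff_deriv -ap // mdegD mdeg1 addn1.
Qed.

Lemma agree_eq a b : (forall d, exists2 p, agree d a p & agree d b p) -> a = b.
Proof.
move=> ab; apply/funext => m; have [p ap bp] := ab (mdeg m).+1.
by rewrite ap // bp.
Qed.

Lemma fps_mulC a b : fps_mul a b = fps_mul b a.
Proof.
apply: agree_eq => d; exists (trunc d a * trunc d b).
  exact/agree_mul/agree_trunc/agree_trunc.
rewrite mulrC; exact/agree_mul/agree_trunc/agree_trunc.
Qed.

Lemma fps_mulA a b c : fps_mul a (fps_mul b c) = fps_mul (fps_mul a b) c.
Proof.
apply: agree_eq => d; exists (trunc d a * (trunc d b * trunc d c)).
  apply/agree_mul; first exact: agree_trunc.
  exact/agree_mul/agree_trunc/agree_trunc.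
rewrite mulrA; apply/agree_mul; last exact: agree_trunc.
exact/agree_mul/agree_trunc/agree_trunc.
Qed.

Lemma fps_mulCA a b c : fps_mul a (fps_mul b c) = fps_mul b (fps_mul a c).
Proof. by rewrite !fps_mulA (fps_mulC a). Qed.

Lemma fps_mul_is_linear a : linear (fps_mul a : series -> series).
Proof.
move=> k x y; apply/funext => m; rewrite !fctE /fps_mul scaler_sumr -big_split /=.
by apply: eq_bigr => i _; rewrite mulrDr /GRing.scale /= mulrCA.
Qed.
HB.instance Definition _ a :=
  GRing.isLinear.Build K series series *:%R (fps_mul a) (fps_mul_is_linear a).

Lemma fps_mulZl k a x : fps_mul (k *: a) x = k *: fps_mul a x.
Proof. by rewrite !(fps_mulC _ x) linearZ. Qed.
Lemma fps_mul_suml (I : finType) (P : pred I) (F : I -> series) x :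
  fps_mul (\sum_(i | P i) F i) x = \sum_(i | P i) fps_mul (F i) x.
Proof.
by rewrite fps_mulC linear_sum; apply: eq_bigr => i _; rewrite fps_mulC.
Qed.

Lemma fps_der_is_linear i : linear (fps_der i : series -> series).
Proof.
by move=> k x y; apply/funext => m; rewrite !fctE /fps_der mulrnDl -mulrnAr.
Qed.
HB.instance Definition _ i :=
  GRing.isLinear.Build K series series *:%R (fps_der i) (fps_der_is_linear i).

Lemma fps_derM i a b :
  fps_der i (fps_mul a b) = fps_mul (fps_der i a) b + fps_mul a (fps_der i b).
Proof.
apply: agree_eq => d; pose p := trunc d.+1 a; pose q := trunc d.+1 b.
have ap : agree d.+1 a p by apply: agree_trunc.
have bq : agree d.+1 b q by apply: agree_trunc.
exists (mderiv i (p * q)); first exact/agree_der/agree_mul.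
have ap' : agree d a p by apply: agreeW ap.
have bq' : agree d b q by apply: agreeW bq.
move=> m md; rewrite mderivM mcoeffD -(agree_mul (agree_der i ap) bq' md).
by rewrite -(agree_mul ap' (agree_der i bq) md).
Qed.

Lemma fps_derC i j a : fps_der i (fps_der j a) = fps_der j (fps_der i a).
Proof.
apply: agree_eq => d; pose p := trunc d.+2 a.
have ap : agree d.+2 a p by apply: agree_trunc.
exists (mderiv i (mderiv j p)); first exact/agree_der/agree_der.
by rewrite mderiv_comm; exact/agree_der/agree_der.
Qed.

Lemma poly_seriesM p q : fps_mul (poly_series p) (poly_series q) = poly_series (p * q).
Proof. by apply: agree_eq => d; exists (p * q) => //; apply: agree_mul. Qed.

Lemma fps_der_poly i p : fps_der i (poly_series p) = poly_series (mderiv i p).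
Proof. by apply/funext => m; rewrite /poly_series mcoeff_deriv. Qed.

Lemma poly_series_inj : injective poly_series.
Proof. by move=> p q pq; apply/mpolyP => m; apply: (congr1 (@^~ m) pq). Qed.

Lemma poly_series0 : poly_series 0 = 0.
Proof. by apply/funext => m; rewrite /poly_series mcoeff0. Qed.

Lemma poly_series1 a : fps_mul (poly_series 1) a = a.
Proof.
apply: agree_eq => d; exists (trunc d a); last exact: agree_trunc.
by rewrite -[trunc d a]mul1r; apply: agree_mul => //; apply: agree_trunc.
Qed.

Lemma poly_series_sum (I : finType) (P : pred I) (F : I -> mpoly n K) :
  poly_series (\sum_(i | P i) F i) = \sum_(i | P i) poly_series (F i).
Proof. by apply/funext => m; rewrite fct_sumE /poly_series raddf_sum. Qed.

Lemma poly_seriesMn p k : poly_series (p *+ k) = poly_series p *+ k.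
Proof.
apply/funext => m.
by rewrite -[p *+ k]scaler_nat -[poly_series p *+ k]scaler_nat /poly_series mcoeffZ.
Qed.

Lemma fps_mul_monomial e a m :
  fps_mul (poly_series (mpolyX K e)) a m =
    if mpoly.lem e m then a (mnm_sub m e) else 0.
Proof.
case: ifP => [em|/negP em].
  rewrite fps_mulC.
  rewrite (agree_mul (agree_trunc (d := (mdeg m).+1) a) (q := mpolyX K e) _) //.
  rewrite -{1}(submK em) addmC mcoeffMX mcoeff_trunc ltnS.
  by rewrite mdegB.
rewrite /fps_mul big1 // => k /eqP km; rewrite /poly_series mcoeffX.
case: eqP => [ek|_]; last by rewrite mul0r.
by case: em; move: (lem_addr k.1 k.2); rewrite km -ek.
Qed.

Section Weights.
Variable wt : 'I_n -> nat.

Definition weight m : nat := \sum_i wt i * m i.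

Lemma weightD m1 m2 : weight (mnm_add m1 m2) = (weight m1 + weight m2)%N.
Proof.
by rewrite -big_split; apply: eq_bigr => i _; rewrite mnmDE mulnDr.
Qed.

Lemma weightUn i l : weight (mnm_muln (mnm1 i) l) = (wt i * l)%N.
Proof.
rewrite /weight (bigD1 i) //= mulmnE mnm1E eqxx mul1n big1 ?addn0 // => j ji.
by rewrite mulmnE mnm1E eq_sym (negbTE ji) mul0n muln0.
Qed.

Lemma weightU i : weight (mnm1 i) = wt i.
Proof. by rewrite -[mnm1 i]mulm1n weightUn muln1. Qed.

Lemma mdeg_le_weight m : (forall i, 0 < wt i)%N -> (mdeg m <= weight m)%N.
Proof. by move=> wt0; rewrite mdegE; apply: leq_sum => i _; apply: leq_pmull. Qed.

(** Homogeneity of weight t - s, written without truncated subtraction. *)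
Definition homogeneous s t a := forall m, a m != 0 -> (weight m + s = t)%N.

(** Multiplying by a series of weight t - s turns a multiplier of weights into a
    shifted one; this is the source of every commutation rule with weight
    components. *)
Lemma homogeneous_mul s t (g : nat -> K) a x m : homogeneous s t a ->
  fps_mul a (fun m => g (weight m + t)%N * x m) m =
  g (weight m + s)%N * fps_mul a x m.
Proof.
move=> ha; rewrite /fps_mul mulr_sumr; apply: eq_bigr => k /eqP km.
have [->|/ha hk] := eqVneq (a k.1) 0; first by rewrite !mul0r mulr0.
have -> : weight m = (weight k.1 + weight k.2)%N by rewrite -weightD km.
by rewrite addnAC hk addnC mulrCA.
Qed.

Lemma homogeneous_der (g : nat -> K) t i x m :
  fps_der i (fun m => g (weight m + t)%N * x m) m =
    g (weight m + wt i + t)%N * fps_der i x m.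
Proof. by rewrite /fps_der weightD weightU mulrnAr. Qed.

(** The product of p with the component of a given weight of a is a component of
    the product, and such a component is a polynomial because the weights are
    positive; so the statement reduces to polynomials having no zero divisor. *)
Lemma homogeneous_regular s t p a : (forall i, 0 < wt i)%N ->
  homogeneous s t (poly_series p) -> p != 0 ->
  fps_mul (poly_series p) a = 0 -> a = 0.
Proof.
move=> wt0 hp p0 pa0; apply/funext => m0; rewrite [RHS]/(0 : K).
pose r := weight m0; pose b : series := fun m => (weight m + t == r + t)%N%:R * a m.
have pb0 : fps_mul (poly_series p) b = 0.
  apply/funext => m.
  by rewrite (homogeneous_mul (fun u => (u == r + t)%N%:R) _ _ hp) pa0 mulr0.
have bE : b = poly_series (trunc r.+1 b).
  apply/funext => m; rewrite /poly_series mcoeff_trunc ltnS; case: leqP => // rm.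
  rewrite /b eqn_add2r; case: eqP => [mr|]; last by rewrite mul0r.
  by move: (mdeg_le_weight m wt0); rewrite mr leqNgt rm.
have /eqP : p * trunc r.+1 b = 0.
  by apply: poly_series_inj; rewrite -poly_seriesM -bE pb0;
    apply/funext => m; rewrite /poly_series mcoeff0.
rewrite mulf_eq0 (negbTE p0) /= => /eqP t0.
have : b m0 = 0 by rewrite bE t0 /poly_series mcoeff0.
by rewrite /b eqxx mul1r.
Qed.

Lemma euler i a m :
  fps_mul (poly_series (mpolyX K (mnm1 i) *+ wt i)) (fps_der i a) m =
  a m *+ (wt i * m i).
Proof.
rewrite poly_seriesMn -scaler_nat fps_mulZl !fctE fps_mul_monomial.
case: ifP => [/mnm_lepP /(_ i)|].
  rewrite mnm1E eqxx => mi; rewrite /fps_der submK; last first.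
    by apply/mnm_lepP => j; rewrite mnm1E; case: eqP => // <-.
  rewrite mnmBE mnm1E eqxx subn1 prednK // /GRing.scale /= mulr_natl.
  by rewrite -mulrnA mulnC.
move/negP => mi; rewrite scaler0 (_ : m i = 0)%N ?muln0 //.
apply/eqP; rewrite -leqn0 leqNgt; apply/negP => mi0; apply: mi.
by apply/mnm_lepP => j; rewrite mnm1E; case: eqP => // <-.
Qed.

(** Action of a function of the weight, dx_j having the weight of x_j. *)
Definition weight_scale (g : nat -> K) (w : {set 'I_n} -> series) :
    {set 'I_n} -> series :=
  fun J m => g (weight m + \sum_(j in J) wt j)%N * w J m.

Lemma weight_scale_is_linear g : linear (weight_scale g).
Proof.
move=> k x y; apply/funext => J; apply/funext => m; rewrite !fctE /weight_scale !fctE.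
by rewrite mulrDr /GRing.scale /= mulrCA.
Qed.
HB.instance Definition _ g := GRing.isLinear.Build K
  ({set 'I_n} -> series) ({set 'I_n} -> series) *:%R
  (weight_scale g) (weight_scale_is_linear g).

Lemma sum_wtD1 (J : {set 'I_n}) j : j \in J ->
  (\sum_(i in J) wt i = wt j + \sum_(i in J :\ j) wt i)%N.
Proof.
move=> jJ; rewrite (bigD1 j) //=; congr (_ + _)%N; apply: eq_bigl => i.
by rewrite !inE andbC.
Qed.

Lemma ext_mul_weight_scale t (a : 'I_n -> series) g w :
  (forall j, homogeneous (wt j) t (a j)) ->
  ext (fun j => fps_mul (a j)) (weight_scale (fun u => g (u + t)%N) w) =
  weight_scale g (ext (fun j => fps_mul (a j)) w).
Proof.
move=> ha; apply/funext => J; apply/funext => m; rewrite /ext /weight_scale !fct_sumE.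
rewrite mulr_sumr; apply: eq_bigr => j jJ; rewrite !fctE /= /GRing.scale /=.
rewrite mulrCA; congr (_ * _); rewrite (sum_wtD1 jJ) addnA.
under eq_fun do rewrite addnAC.
exact: (homogeneous_mul (fun u => g (u + _)%N) _ _ (ha j)).
Qed.

Lemma ext_der_weight_scale g w :
  ext (fun j => fps_der j) (weight_scale g w) = weight_scale g (ext (fun j => fps_der j) w).
Proof.
apply/funext => J; apply/funext => m; rewrite /ext /weight_scale !fct_sumE.
rewrite mulr_sumr; apply: eq_bigr => j jJ; rewrite !fctE /= /GRing.scale /=.
by rewrite mulrCA (sum_wtD1 jJ) addnA homogeneous_der.
Qed.

End Weights.
End FormalAlgebra.

(** * Division by df and vanishing for admissible series *)

Section AdmissibleSeries.
Variables (K : numFieldType) (n : nat).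
Local Notation series := (multi_index n -> K).
Implicit Types (a b c : series) (p q : mpoly n K) (m e : multi_index n).

(** The spaces of power series in which the argument takes place.  The field
    [adm_le] gives stability under projections to sets of monomials and under
    division by integers, [adm_shift] under division by monomials. *)
Record admissible (adm : series -> Prop) : Prop := Admissible {
  adm_linear : forall k a b, adm a -> adm b -> adm (k *: a + b);
  adm_mul : forall a b, adm a -> adm b -> adm (fps_mul a b);
  adm_der : forall i a, adm a -> adm (fps_der i a);
  adm_le : forall a b, adm a -> (forall m, `|b m| <= `|a m|) -> adm b;
  adm_shift : forall e a, adm a -> adm (fun m => a (mnm_add m e));
  adm_poly : forall p, adm (poly_series p)
}.

Variable adm : series -> Prop.
Hypothesis admP : admissible adm.

Let adm0 : adm 0.
Proof.
by rewrite -(poly_series0 K n); apply: adm_poly.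
Qed.
Let admZ k a : adm a -> adm (k *: a).
Proof. by move=> ha; rewrite -[_ *: _]addr0; apply: adm_linear. Qed.
Let admD a b : adm a -> adm b -> adm (a + b).
Proof. by move=> ha hb; rewrite -[a]scale1r; apply: adm_linear. Qed.
Let adm_sum (I : finType) (P : pred I) (F : I -> series) :
  (forall i, P i -> adm (F i)) -> adm (\sum_(i | P i) F i).
Proof. by move=> aF; apply: big_ind => //; apply: admD. Qed.

Section MonomialRegularSequence.
Variable e : 'I_n -> nat.

Let g (i : 'I_n) : series := poly_series (mpolyX K (mnm_muln (mnm1 i) (e i))).

Let gE i a m : fps_mul (g i) a m =
  if (e i <= m i)%N then a (mnm_sub m (mnm_muln (mnm1 i) (e i))) else 0.
Proof.
rewrite fps_mul_monomial; congr (if _ then _ else _).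
apply/mnm_lepP/idP => [/(_ i)|ei j]; first by rewrite mulmnE mnm1E eqxx mul1n.
by rewrite mulmnE mnm1E; case: eqP => [<-|]; rewrite ?mul1n ?mul0n.
Qed.

(** For the converse, attribute each monomial of a to the first generator that
    divides it, and divide the resulting pieces. *)
Lemma monomial_idealP (r : nat) a : adm a ->
  (exists2 t : 'I_n -> series, forall i, adm (t i) &
    a = \sum_(i < n | (i < r)%N) fps_mul (g i) (t i)) <->
  (forall m, a m != 0 -> exists2 i : 'I_n, (i < r)%N & (e i <= m i)%N).
Proof.
move=> aa; split=> [[t at_ ->] m|supp].
  rewrite fct_sumE => nz; apply: contrapT => no; case/eqP: nz.
  apply: big1 => i ir; rewrite gE; case: ifP => // ei; case: no; by exists i.
pose first (i : 'I_n) m := [&& (i < r)%N, (e i <= m i)%N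
  & [forall j : 'I_n, (j < i)%N ==> ~~ (e j <= m j)%N]].
pose u i : series := fun m => (first i m)%:R * a m.
exists (fun i m => u i (mnm_add m (mnm_muln (mnm1 i) (e i)))).
  move=> i; apply: (adm_shift admP); apply: (adm_le admP aa) => m.
  rewrite /u normrM normr_nat; case: (first i _); rewrite ?mul1r //.
  by rewrite mul0r normr_ge0.
apply/funext => m; rewrite fct_sumE.
have gu i : fps_mul (g i) (fun m => u i (mnm_add m (mnm_muln (mnm1 i) (e i)))) m
            = u i m.
  rewrite gE; case: ifP => [ei|ei].
    rewrite submK //; apply/mnm_lepP => j; rewrite mulmnE mnm1E.
    by case: eqP => [<-|]; rewrite ?mul1n ?mul0n.
  by rewrite /u /first ei andbF mul0r.
under eq_bigr do rewrite gu.
have [am0|am0] := eqVneq (a m) 0.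
  by rewrite am0 big1 // => i _; rewrite /u am0 mulr0.
have [i0 i0r ei0] := supp m am0.
have [i ei imin] := @arg_minnP _ i0 (fun i : 'I_n => e i <= m i)%N val ei0.
have ir : (i < r)%N by apply: leq_ltn_trans i0r; apply: imin.
rewrite (bigD1 i) //= big1 => [|j /andP[jr ji]].
  rewrite addr0 /u (_ : first i m) ?mul1r // /first ir ei.
  by apply/forallP => j; apply/implyP; apply: contraTN => /imin; rewrite leqNgt.
rewrite /u (_ : first j m = false) ?mul0r //; apply/negP => /and3P[_ ej /forallP H].
have := imin _ ej; rewrite leq_eqVlt eq_sym; have -> /= : (j == i :> nat) = false.
  exact: negbTE.
by move=> ij; move: (H i); rewrite ij ei.
Qed.

(** Multiplying by a power of x_r does not change the exponents of the other
    variables, so the criterion on monomials passes to the quotient. *)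
Lemma monomial_regular (r : 'I_n) a : adm a ->
  (exists2 t : 'I_n -> series, forall i, adm (t i) &
    fps_mul (g r) a = \sum_(i < n | (i < r)%N) fps_mul (g i) (t i)) ->
  exists2 t : 'I_n -> series, forall i, adm (t i) &
    a = \sum_(i < n | (i < r)%N) fps_mul (g i) (t i).
Proof.
move=> aa /monomial_idealP H; apply/(monomial_idealP _ aa) => m am0.
have [||i ir] := H _ (mnm_add m (mnm_muln (mnm1 r) (e r))).
- by apply: adm_mul => //; apply: adm_poly.
- by rewrite gE mnmDE mulmnE mnm1E eqxx mul1n leq_addl addmK.
rewrite mnmDE mulmnE mnm1E; case: eqP => [ri|_]; first by rewrite ri ltnn in ir.
by rewrite mul0n addn0 => ei; exists i.
Qed.

End MonomialRegularSequence.

Variables (wt : 'I_n -> nat) (N : nat) (p : mpoly n K).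
Hypothesis wt_gt0 : forall i, (0 < wt i)%N.
Hypothesis p_qh :
  \sum_(i < n) (mpolyX K (mnm1 i) * mderiv i p) *+ wt i = p *+ N.

Lemma quasihomogeneous_weight : homogeneous wt 0 N (poly_series p).
Proof.
move=> m pm0; rewrite addn0; have := congr1 (mcoeff m) p_qh.
rewrite raddf_sum /= mcoeffMn.
rewrite (eq_bigr (fun i => mcoeff m p *+ (wt i * m i))) => [|i _].
  rewrite sumrMnr -!(mulr_natr (mcoeff m p)) => /(mulfI pm0)/eqP.
  by rewrite eqr_nat => /eqP.
by have := euler wt i (poly_series p) m;
  rewrite fps_der_poly poly_seriesM /poly_series mulrnAl.
Qed.

Let f := poly_series p.
Let df (j : 'I_n) : {linear series -> series} := fps_mul (fps_der j f).

Hypothesis p_codim : exists (M : nat) (b : 'I_M -> series),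
  forall a, adm a -> exists (c : 'I_M -> K) (h : 'I_n -> series),
    (forall i, adm (h i)) /\
    a - \sum_(j < M) c j *: b j = \sum_(i < n) fps_mul (h i) (fps_der i f).

Lemma der_homogeneous j : homogeneous wt (wt j) N (fps_der j f).
Proof.
move=> m; rewrite /fps_der; have [->|pm _] := eqVneq (f (mnm_add m (mnm1 j))) 0.
  by rewrite mul0rn eqxx.
by have := quasihomogeneous_weight pm; rewrite addn0 weightD weightU.
Qed.

(** The powers of x_i are linearly dependent modulo the Jacobian ideal, which
    puts a nonzero polynomial in x_i into it.  The partial derivatives being
    quasihomogeneous, the ideal contains each weight component, hence a single
    power of x_i. *)
Lemma power_in_jacobian i : exists l (h : 'I_n -> series),
  (forall j, adm (h j)) /\
  poly_series (mpolyX K (mnm_muln (mnm1 i) l)) = \sum_j fps_mul (h j) (fps_der j f).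
Proof.
have [M [b Hb]] := p_codim.
pose X l : series := poly_series (mpolyX K (mnm_muln (mnm1 i) l)).
have /choice[c /choice[h Hh]] : forall l : 'I_M.+1, exists c : 'I_M -> K,
    exists h : 'I_n -> series, (forall i, adm (h i)) /\
    X l - \sum_(j < M) c j *: b j = \sum_(i < n) fps_mul (h i) (fps_der i f).
  by move=> l; apply/Hb/(adm_poly admP).
pose C : 'M[K]_(M.+1, M) := \matrix_(l, j) c l j.
have : kermx C != 0.
  by rewrite kermx_eq0 /row_free neq_ltn ltnS rank_leq_col.
move=> /rowV0Pn[v /sub_kermxP vC v0].
have [l0 vl0] : exists l, v 0 l != 0.
  apply: contrapT => no; case/eqP: v0; apply/rowP => l; rewrite mxE.
  by apply: contrapT => /eqP vl; apply: no; exists l.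
pose H j : series := \sum_l v 0 l *: h l j.
have HE : \sum_l v 0 l *: X l = \sum_j fps_mul (H j) (fps_der j f).
  transitivity (\sum_l v 0 l *: (X l - \sum_(j < M) c l j *: b j)).
    under [RHS]eq_bigr do rewrite scalerBr scaler_sumr.
    rewrite sumrB exchange_big [X in _ - X]big1 /= ?subr0 // => j _.
    under eq_bigr do rewrite scalerA.
    rewrite -scaler_suml; have /rowP/(_ j) := vC; rewrite !mxE.
    by under eq_bigr do rewrite mxE; move=> ->; rewrite scale0r.
  under eq_bigr do rewrite (proj2 (Hh _)) scaler_sumr.
  rewrite exchange_big; apply: eq_bigr => j _; rewrite /H fps_mul_suml.
  by apply: eq_bigr => l _; rewrite fps_mulZl.
exists l0, (fun j m => (weight wt m + N == wt i * l0 + wt j)%N%:R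
                       * ((v 0 l0)^-1 *: H j) m); split.
  move=> j; apply: (adm_le admP (a := (v 0 l0)^-1 *: H j)).
    by apply/admZ/adm_sum => l _; apply/admZ/(proj1 (Hh l)).
  move=> m; rewrite normrM normr_nat; case: eqP; rewrite ?mul1r // mul0r.
  by rewrite normr_ge0.
apply/funext => m; rewrite fct_sumE.
under eq_bigr => j _ do rewrite fps_mulC
  (homogeneous_mul (fun u => (u == wt i * l0 + wt j)%N%:R) _ _
     (@der_homogeneous j)) eqn_add2r linearZ /= fps_mulC.
rewrite -mulr_sumr.
have -> : \sum_j ((v 0 l0)^-1 *: fps_mul (H j) (fps_der j f)) m =
   (v 0 l0)^-1 * (\sum_l v 0 l *: X l) m.
  by rewrite HE fct_sumE mulr_sumr.
rewrite fct_sumE /poly_series mcoeffX; case: eqP => [mE|mN].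
  rewrite -mE weightUn eqxx mul1r (bigD1 l0) //= big1 ?addr0 => [|l ll0].
    by rewrite !fctE /X /poly_series mcoeffX eqxx /GRing.scale /= mulr1 mulVf.
  rewrite !fctE /X /poly_series mcoeffX.
  case: eqP => [/mnmP/(_ i)|]; last by rewrite scaler0.
  rewrite !mulmnE mnm1E eqxx !mul1n => /val_inj lE; by rewrite lE eqxx in ll0.
case: eqP => [mw|_]; last by rewrite mul0r.
rewrite mul1r big1 ?mulr0 // => l _; rewrite !fctE /X /poly_series mcoeffX.
case: eqP => [mE|]; last by rewrite scaler0.
move: mw; rewrite -mE weightUn => /eqP; rewrite eqn_pmul2l ?wt_gt0 // => /eqP lE.
by case: mN; rewrite -mE lE.
Qed.


Let form (k : nat) (w : {set 'I_n} -> series) : Prop :=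
  forall J : {set 'I_n}, adm (w J) /\ (#|J| != k -> w J = 0).

Let form0 k : form k 0. Proof. by []. Qed.

Let form_linear k l x y : form k x -> form k y -> form k (l *: x + y).
Proof.
move=> fx fy J; have [ax x0] := fx J; have [ay y0] := fy J.
split=> [|Jk]; first exact: adm_linear.
by change (l *: x J + y J = 0); rewrite x0 // y0 // scaler0 addr0.
Qed.

Let form_ext k (P : 'I_n -> {linear series -> series}) x :
  (forall j a, adm a -> adm (P j a)) -> form k x -> form k.+1 (ext P x).
Proof.
move=> admPj fx J; split=> [|Jk].
  by apply: adm_sum => j _; apply/admZ/admPj; have [] := fx (J :\ j).
rewrite /ext big1 // => j jJ; rewrite (proj2 (fx _)) ?linear0 ?scaler0 //.
by move: Jk; rewrite (cardsD1 j) jJ.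
Qed.

Let form_contr k (P : 'I_n -> {linear series -> series}) x :
  (forall j a, adm a -> adm (P j a)) -> form k.+1 x -> form k (contr P x).
Proof.
move=> admPj fx J; split=> [|Jk].
  by apply: adm_sum => j _; apply/admZ/admPj; have [] := fx (j |: J).
rewrite /contr big1 // => j jJ; rewrite (proj2 (fx _)) ?linear0 ?scaler0 //.
by rewrite cardsU1 jJ.
Qed.

Definition fmul : ({set 'I_n} -> series) -> {set 'I_n} -> series :=
  fun w J => fps_mul f (w J).

Lemma fmul_is_linear : linear fmul.
Proof.
by move=> k x y; apply/funext => J; rewrite !fctE /fmul !fctE linearP.
Qed.
HB.instance Definition _ := GRing.isLinear.Build K
  ({set 'I_n} -> series) ({set 'I_n} -> series) *:%R fmul fmul_is_linear.

Let der (j : 'I_n) : {linear series -> series} := fps_der j.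
Let euler_field (j : 'I_n) : {linear series -> series} :=
  fps_mul (poly_series (mpolyX K (mnm1 j) *+ wt j)).

Lemma fmul_inj w : p != 0 -> fmul w = 0 -> w = 0.
Proof.
move=> p0 fw; apply/funext => J.
exact: (homogeneous_regular wt_gt0 quasihomogeneous_weight p0 (congr1 (@^~ J) fw)).
Qed.

(** Otherwise the Jacobian ideal would be zero and could not contain a monomial. *)
Lemma p_neq0 : (0 < n)%N -> p != 0.
Proof.
move=> n0; apply/eqP => p0; have [l [h [_]]] := power_in_jacobian (Ordinal n0).
rewrite /f p0 big1 => [|j _].
  move=> /(congr1 (@^~ (mnm_muln (mnm1 (Ordinal n0)) l))).
  by rewrite /poly_series mcoeffX eqxx => /eqP; rewrite oner_eq0.
by rewrite fps_der_poly linear0 /= poly_series0 linear0.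
Qed.

Lemma ext_df_exact k w : (k.+1 < n)%N -> form k.+1 w -> ext df w = 0 ->
  exists2 v, form k v & w = ext df v.
Proof.
move=> kn fw w0.
have /choice[e /choice[h Hh]] := power_in_jacobian.
pose hm i j : {linear series -> series} := fps_mul (h i j).
have hphiE i a : hphi df hm i a =
    fps_mul (poly_series (mpolyX K (mnm_muln (mnm1 i) (e i)))) a.
  rewrite (proj2 (Hh i)) fps_mul_suml; apply: eq_bigr => j _.
  by rewrite /hm /df /= fps_mulA.
have idealE r a : in_ideal adm df hm r a <->
    exists2 t : 'I_n -> series, forall i, adm (t i) & a =
      \sum_(i < n | (i < r)%N)
        fps_mul (poly_series (mpolyX K (mnm_muln (mnm1 i) (e i)))) (t i).
  by split=> -[t at_ ->]; exists t => //; apply: eq_bigr => i _; rewrite hphiE.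
have [||||||||||eta [Seta etak ->]] :=
  @koszul_exact K series n adm df hm _ _ _ _ _ _ _ _ k w kn _ _ w0.
- exact: adm0.
- exact: adm_linear.
- move=> j x ax; apply: adm_mul => //; apply: adm_der => //; exact: adm_poly.
- by move=> i j x ax; apply: adm_mul => //; apply: (proj1 (Hh i)).
- by move=> i j x; apply: fps_mulCA.
- by move=> i j l x; apply: fps_mulCA.
- by move=> i j l m x; apply: fps_mulCA.
- by move=> r x ax /idealE; rewrite hphiE => /(monomial_regular ax)/idealE.
- by move=> J; have [] := fw J.
- by move=> J; have [_] := fw J.
by exists eta => // J; split; [apply: Seta|apply: etak].
Qed.

Lemma d_f_exact (q : nat) (w : {set 'I_n} -> series) : (q.+3 < n)%N ->
  form q.+2 w -> fmul (ext der w) = ext df w *+ q.+2 ->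
  exists2 v, form q.+1 v & w = fmul (ext der v) - ext df v *+ q.+1.
Proof.
move=> qn fw cw; have n_gt0 : (0 < n)%N by apply: leq_ltn_trans qn.
have fdf i j : fps_der i (fps_der j f) = fps_der j (fps_der i f).
  exact: fps_derC.
apply: (@pole_order_exact K ({set 'I_n} -> series) n N fmul (ext df) (ext der)
  (contr euler_field) (weight_scale wt) form) => //.
- by move=> x; apply: fmul_inj; apply: p_neq0.
- by move=> x; apply: ext_ext_sym => j k a; apply: fps_mulCA.
- by move=> x; apply: ext_ext_sym => j k a; apply: fps_derC.
- move=> x; apply/eqP; rewrite -addr_eq0; apply/eqP; apply: ext_ext_antisym.
  move=> j k a /=; rewrite !fps_derM fdf -!addrA; congr (_ + _).
  exact: addrC.
- move=> x; apply/funext => J; rewrite /= /fmul /ext /= linear_sum.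
  by apply: eq_bigr => j _; rewrite linearZ /= fps_mulCA.
- move=> x; apply/funext => J.
  change (ext der (fmul x) J = ext df x J + fps_mul f (ext der x J)).
  rewrite /ext linear_sum -big_split.
  by apply: eq_bigr => j _; rewrite /fmul /der /= fps_derM linearZ /= scalerDr.
- move=> x; apply/funext => J; rewrite /= /fmul /contr /= linear_sum.
  by apply: eq_bigr => j _; rewrite linearZ /= fps_mulCA.
- move=> x; apply/funext => J.
  change (contr euler_field (ext df x) J + ext df (contr euler_field x) J =
          (fmul x *+ N) J); rewrite addrC -scaler_nat.
  rewrite cartan => [|j k a _]; last exact: fps_mulCA.
  transitivity (fps_mul (poly_series (p *+ N)) (x J)).
    rewrite -p_qh poly_series_sum fps_mul_suml; apply: eq_bigr => j _.
    rewrite /df /euler_field /= [fps_mul (fps_der j f) _]fps_mulCA if_same.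
    by rewrite fps_mulA /f fps_der_poly poly_seriesM mulrnAl.
  by rewrite poly_seriesMn -scaler_nat fps_mulZl.
- move=> x; apply/funext => J.
  change (contr euler_field (ext der x) J + ext der (contr euler_field x) J =
          weight_scale wt (fun t => t%:R) x J); rewrite addrC.
  rewrite cartan => [|j k a jk]; last first.
    rewrite /= fps_derM fps_der_poly linearMn /= mderivX mnm1E eq_sym.
    rewrite (negbTE jk) scale0r mul0rn poly_series0 (fps_mulC 0).
    by rewrite [X in X + _]linear0 add0r.
  apply/funext => m; rewrite fct_sumE /weight_scale.
  transitivity (\sum_j (x J m *+ (wt j * m j) +
                        if j \in J then x J m *+ wt j else 0)).
    apply: eq_bigr => j _; rewrite -[_ *+ (wt j * m j)]euler.
    case: ifP => _; last by rewrite addr0.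
    rewrite /der /euler_field /= fps_derM addrC; congr (_ + _).
    have UU : mnm_sub (mnm1 j) (mnm1 j) = mnm0.
      by apply/mnmP => i; rewrite mnmBE subnn mnm0E.
    rewrite fps_der_poly linearMn /= mderivX mnm1E eqxx scale1r UU mpolyX0.
    rewrite poly_seriesMn -[poly_series 1 *+ _]scaler_nat fps_mulZl.
    by rewrite poly_series1 -[RHS]scaler_nat.
  by rewrite big_split -big_mkcond /= !sumrMnr -mulrnDr mulr_natl.
- move=> a b x; apply/funext => J; apply/funext => m.
  exact: mulrA.
- move=> c a b x; apply/funext => J; apply/funext => m.
  by rewrite /= /weight_scale !fctE mulrDl -mulrA.
- move=> x; apply/funext => J; apply/funext => m.
  exact: mul1r.
- by move=> a x; apply: ext_der_weight_scale.
- by move=> a x; apply: ext_mul_weight_scale => j; apply: der_homogeneous.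
- move=> a x; apply/funext => J; apply/funext => m.
  change (fps_mul f (fun m => a (weight wt m + \sum_(j in J) wt j + N)%N * x J m) m
          = a (weight wt m + \sum_(j in J) wt j)%N * fps_mul f (x J) m).
  under eq_fun do rewrite addnAC.
  rewrite (homogeneous_mul (fun u => a (u + _)%N) _ _ quasihomogeneous_weight).
  by rewrite addn0.
- move=> k x fx J; have [ax x0] := fx J.
  change (adm (fps_mul f (x J)) /\ (#|J| != k -> fps_mul f (x J) = 0)).
  split=> [|/x0 ->].
    by apply: adm_mul => //; apply: adm_poly.
  exact: linear0.
- by move=> k x; apply: (form_ext (P := der)) => j a; apply: (adm_der admP j).
- by move=> k x; apply: (form_contr (P := euler_field)) => j a;
  apply: (adm_mul admP (adm_poly admP _)).
- move=> k a x a1 fx J; have [ax x0] := fx J; split=> [|/x0 E].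
    apply: (adm_le admP ax) => m; rewrite /= /weight_scale normrM.
    by rewrite ler_piMl.
  by apply/funext => m; rewrite /= /weight_scale E mulr0.
- move=> k x fx; apply/funext => J; apply/funext => m; rewrite /= /weight_scale.
  have [->|[j jJ]] := set_0Vmem J.
    by rewrite (proj2 (fx _)) ?mulr0 // cards0.
  by rewrite (sum_wtD1 _ jJ) addnCA addn_eq0 eqn0Ngt wt_gt0 mul0r.
- by move=> k x; apply: ext_df_exact.
Qed.
End AdmissibleSeries.

(** * Passage from germs to their Taylor series *)

Lemma fun_mulrn (K : numFieldType) (T : Type) (V : lmodType K) (F : T -> V) k x :
  (F *+ k) x = F x *+ k.
Proof. by rewrite -[F *+ k]scaler_nat -[RHS]scaler_nat. Qed.

Section Transfer.
Variables (K : numFieldType) (n : nat) (C : category K n).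
Local Notation series := (multi_index n -> K).

(** [rel g a] relates a representative g of a germ to its Taylor series a; the
    fields say that this identifies germs with admissible series, compatibly
    with all operations that occur in the definition of the complex. *)
Record realization (adm : series -> Prop) (rel : rep C -> series -> Prop) :
    Prop := Realization {
  rel_adm : forall g a, rel g a -> adm a;
  rel_germ : forall g a, rel g a -> germ g;
  germ_rel : forall g, germ g -> exists a, rel g a;
  adm_rel : forall a, adm a -> exists g, rel g a;
  rel_same : forall g h a b, rel g a -> rel h b -> same g h <-> a = b;
  rel_linear : forall k g h a b, rel g a -> rel h b ->
    rel (k *: g + h) (k *: a + b);
  rel_mul : forall g h a b, rel g a -> rel h b -> rel (gmul g h) (fps_mul a b);
  rel_der : forall i g a, rel g a -> rel (pder i g) (fps_der i a);
  rel_poly : forall p, rel (of_poly C p) (poly_series p)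
}.

Variables (adm : series -> Prop) (rel : rep C -> series -> Prop).
Hypotheses (admP : admissible adm) (relP : realization adm rel).

Let rel0 : rel 0 0.
Proof.
have := rel_linear relP (-1) (rel_poly relP 0) (rel_poly relP 0).
by rewrite !scaleN1r !addNr.
Qed.

Let relZ k g a : rel g a -> rel (k *: g) (k *: a).
Proof. by move=> ga; rewrite -[k *: g]addr0 -[k *: a]addr0; apply: (rel_linear relP). Qed.

Let relD g h a b : rel g a -> rel h b -> rel (g + h) (a + b).
Proof. by move=> ga hb; rewrite -[g]scale1r -[a]scale1r; apply: (rel_linear relP). Qed.

Let relB g h a b : rel g a -> rel h b -> rel (g - h) (a - b).
Proof.
by move=> ga hb; rewrite -[- h]scaleN1r -[- b]scaleN1r; apply/relD/relZ.
Qed.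

Let rel_sum (I : finType) (P : pred I) F G :
  (forall i, P i -> rel (F i) (G i)) ->
  rel (\sum_(i | P i) F i) (\sum_(i | P i) G i).
Proof. by move=> FG; apply: (big_ind2 (fun g a => rel g a)) => // *; apply: relD. Qed.

Let relMn g a k : rel g a -> rel (g *+ k) (a *+ k).
Proof. by move=> ga; rewrite -(scaler_nat k g) -(scaler_nat k a); apply: relZ. Qed.

Let rel_d_f k p w v : (forall J, rel (w J) (v J)) -> forall J,
  rel (d_f (of_poly C p) k w J)
      (fps_mul (poly_series p) (ext (fun j => fps_der j) v J)
       - ext (fun j => fps_mul (fps_der j (poly_series p))) v J *+ k).
Proof.
move=> wv J; have pP := rel_poly relP p; apply/relB/relMn.
  apply: (rel_mul relP) => //; apply: rel_sum => j _; apply: relZ; exact: (rel_der relP).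
apply: rel_sum => j _; apply: relZ; apply: (rel_mul relP) => //; exact: (rel_der relP).
Qed.

Let codim_transfer p : finite_codimension (of_poly C p) ->
  exists (M : nat) (b : 'I_M -> series),
  forall a, adm a -> exists (c : 'I_M -> K) (h : 'I_n -> series),
    (forall i, adm (h i)) /\
    a - \sum_(j < M) c j *: b j =
      \sum_(i < n) fps_mul (h i) (fps_der i (poly_series p)).
Proof.
move=> [M [g [gg Hg]]].
have /choice[b gb] : forall j, exists b, rel (g j) b.
  by move=> j; apply: (germ_rel relP).
exists M, b => a /(adm_rel relP)[x xa].
have [c [y gy xy]] := Hg x (rel_germ relP xa).
have /choice[h yh] : forall i, exists h, rel (y i) h.
  by move=> j; apply: (germ_rel relP).
exists c, h; split; first by move=> i; apply: (rel_adm relP) (yh i).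
apply/(rel_same relP _ _).1: xy.
  by apply/relB/rel_sum => // j _; apply: relZ.
apply: rel_sum => i _; apply: (rel_mul relP) => //; apply: (rel_der relP) => //.
exact: (rel_poly relP).
Qed.

Theorem H_trivial_transfer p N k : quasihomogeneous p N ->
  finite_codimension (of_poly C p) -> (2 <= k <= n - 2)%N ->
  H_trivial (of_poly C p) k.
Proof.
move=> [wt [wt_gt0 p_qh]] fin; case: k => [|[|q]] //= qn w [fw cw].
have {}qn : (q.+3 < n)%N by lia.
have /choice[a wa] : forall J, exists a, rel (w J) a.
  move=> J; have := fw J; case: ifP => _ => [|->]; first exact: (germ_rel relP).
  by exists 0.
have fa (J : {set 'I_n}) : adm (a J) /\ (#|J| != q.+2 -> a J = 0).
  split; first exact: (rel_adm relP) (wa J).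
  move=> /negbTE Jq; have := fw J; rewrite Jq => wJ.
  apply/(rel_same relP (wa J) rel0); rewrite wJ.
  exact/(rel_same relP rel0 rel0).
have [|v fv av] := d_f_exact admP wt_gt0 p_qh (codim_transfer fin) qn fa.
  apply/funext => J; rewrite fun_mulrn; apply/eqP; rewrite -subr_eq0; apply/eqP.
  have := rel_d_f q.+2 p wa J.
  by move=> /(rel_same relP) /(_ rel0) /iffLR /(_ (cw J)).
have /choice[u uv] : forall J : {set 'I_n}, exists g,
    rel g (v J) /\ (#|J| != q.+1 -> g = 0).
  move=> J; have [av_ v0] := fv J; have [Jq|/v0 ->] := eqVneq #|J| q.+1.
    by have [g gv] := adm_rel relP av_; exists g.
  by exists 0.
exists u.
  move=> J; have [uvJ u0] := uv J; case: eqP => [_|/eqP/u0 //].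
  exact: (rel_germ relP) uvJ.
move=> J; apply/(rel_same relP (wa J) (rel_d_f q.+1 p (fun J => (uv J).1) J)).
rewrite {1}av -(fun_mulrn (ext _ v)) //.
Qed.

End Transfer.

Lemma admissible_formal (K : numFieldType) (n : nat) :
  @admissible K n (fun=> True).
Proof. by []. Qed.

Lemma realization_formal (K : numFieldType) (n : nat) :
  @realization K n (formal_category K n) (fun=> True) eq.
Proof.
split=> //.
- by move=> g _; exists g.
- by move=> a _; exists a.
- by move=> g h a b <- <-.
- by move=> k g h a b <- <-.
- by move=> g h a b <- <-.
- by move=> i g a <-.
Qed.

(** * Estimates for power series with geometric bounds *)

Section PowerSeriesEstimates.
Variables (K : numFieldType) (n : nat).
Local Notation series := (multi_index n -> K).
Implicit Types (a b : series) (p q : mpoly n K) (m : multi_index n) (x : 'I_n -> K).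

(** Convergence near 0 is handled through this geometric bound, which is easier
    to carry through products and derivatives than absolute summability. *)
Definition bounded_by (C R : K) a := forall m, `|a m| <= C * R ^+ mdeg m.

Definition exponents (d : nat) (m : bmultinom n d) : {ffun 'I_n -> 'I_d.+1} :=
  [ffun i => inord (m i)].

Lemma mnm_le_mdeg m i : (m i <= mdeg m)%N.
Proof. by rewrite mdegE (bigD1 i) //= leq_addr. Qed.

Lemma exponentsE d (m : bmultinom n d) i : exponents m i = m i :> nat.
Proof.
rewrite ffunE inordK // ltnS; apply: leq_trans (mnm_le_mdeg m i) _.
exact/ltnW/(valP m).
Qed.

Lemma exponents_inj d : injective (@exponents d).
Proof.
move=> m1 m2 e12; apply/val_inj/mnmP => i.
by rewrite -!exponentsE e12.
Qed.

Lemma half_geometric d : \sum_(j < d) (2^-1 : K) ^+ j <= 2.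
Proof.
suff -> : \sum_(j < d) (2^-1 : K) ^+ j = 2 - 2 * 2^-1 ^+ d.
  by rewrite lerBlDr lerDl mulr_ge0 ?exprn_ge0 ?invr_ge0 ?ler0n.
elim: d => [|d IH]; first by rewrite big_ord0 expr0 mulr1 subrr.
by rewrite big_ord_recr /= IH exprS mulVKf ?pnatr_eq0 //; ring.
Qed.

(** Monomials of degree below d inject into the functions from variables to
    exponents at most d, over which the sum factors into n geometric sums, each
    at most 2. *)
Lemma sum_half_le d : \sum_(m : bmultinom n d) (2^-1 : K) ^+ mdeg m <= 2 ^+ n.
Proof.
pose G (f : {ffun 'I_n -> 'I_d.+1}) : K := \prod_i 2^-1 ^+ f i.
have G0 f : 0 <= G f by apply: prodr_ge0 => i _; rewrite exprn_ge0 ?invr_ge0 ?ler0n.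
apply: (@le_trans _ _ (\sum_f G f)); last first.
  rewrite /G -(bigA_distr_bigA (fun _ j => (2^-1 : K) ^+ val j)).
  apply: (@le_trans _ _ (\prod_(i < n) 2)); last by rewrite prodr_const card_ord.
  apply: ler_prod => i _; rewrite half_geometric andbT; apply: sumr_ge0 => j _.
  by rewrite exprn_ge0 ?invr_ge0 ?ler0n.
rewrite (eq_bigr (fun m : bmultinom n d => G (exponents m))) => [|m _]; last first.
  by rewrite /G -expr_sum mdegE; congr (_ ^+ _); apply: eq_bigr => i _; rewrite exponentsE.
have := @big_imset _ _ _ _ _ (@exponents d) predT G.
rewrite /= => /(_ _ _ (in2W (@exponents_inj d))) <-.
rewrite big_mkcond; apply: ler_sum => f _; case: ifP => // _; exact: G0.
Qed.

(** A splitting of m is determined by its first part, whose n exponents are at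
    most mdeg m; a crude bound by powers of 2 suffices to stay geometric. *)
Lemma card_splittings m :
  (#|[pred k : bmultinom n (mdeg m).+1 * bmultinom n (mdeg m).+1
      | m == mnm_add k.1 k.2]| <= (2 ^ n) ^ (mdeg m).+1)%N.
Proof.
rewrite -(card_in_image (f := fun k => exponents k.1)); last first.
  move=> [k1 k2] [l1 l2] /eqP + /eqP + /exponents_inj /= kl1.
  rewrite -{}kl1 /= => E1 E2; congr (_, _); apply/val_inj.
  by apply: (@addmI _ (val k1)); rewrite -E1 -E2.
apply: leq_trans (max_card _) _.
rewrite card_ffun !card_ord -expnM mulnC expnM.
have le_exp (s t e : nat) : (s <= t)%N -> (s ^ e <= t ^ e)%N.
  by move=> st; elim: e => // e IHe; rewrite !expnS leq_mul.
exact/le_exp/ltn_expl.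
Qed.

Lemma mevalE_trunc D x p : (msize p <= D)%N ->
  meval x p = \sum_(m : bmultinom n D) mcoeff m p * \prod_i x i ^+ m i.
Proof.
move=> pD; rewrite {1}(mpolywE pD) raddf_sum; apply: eq_bigr => m _ /=.
by rewrite mevalZ mevalX.
Qed.

Lemma meval_trunc d x a :
  meval x (trunc d a) = \sum_(m : bmultinom n d) a m * \prod_i x i ^+ m i.
Proof. by rewrite raddf_sum; apply: eq_bigr => m _ /=; rewrite mevalZ mevalX. Qed.

Lemma norm_monomial_le r x m : (forall i, `|x i| <= r) ->
  `|\prod_i x i ^+ m i| <= r ^+ mdeg m.
Proof.
move=> xr; rewrite normr_prod mdegE expr_sum; apply: ler_prod => i _.
by rewrite normr_ge0 normrX lerXn2r ?nnegrE // (le_trans _ (xr i)).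
Qed.

Lemma norm_sum_quarter C u D (t : bmultinom n D -> K) :
  0 <= C -> 0 <= u <= 2^-1 ->
  (forall m : bmultinom n D, `|t m| <= C * u ^+ mdeg m) ->
  `|\sum_m t m| <= C * 2 ^+ n.
Proof.
move=> C0 /andP[u0 u1] tm; apply: (le_trans (ler_norm_sum _ _ _)).
apply: (@le_trans _ _ (\sum_(m : bmultinom n D) C * 2^-1 ^+ mdeg m)).
  apply: ler_sum => m _; apply: le_trans (tm m) _; apply: ler_wpM2l => //.
  by rewrite lerXn2r ?nnegrE // invr_ge0 ler0n.
by rewrite -mulr_sumr ler_wpM2l // sum_half_le.
Qed.

(** On the polydisc of radius 1 / (4 R) the monomial of exponent m is at most
    C / 4^(mdeg m), which is split into two factors 1 / 2^(mdeg m): one pays for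
    the summation over m, the other gives the decay in d. *)
Lemma norm_tail_le C R r x d q :
  0 <= C -> 1 <= R -> 0 < r -> 4 * (R * r) <= 1 ->
  (forall i, `|x i| <= r) ->
  (forall m, `|mcoeff m q| <= C * R ^+ mdeg m) ->
  (forall m, (mdeg m < d)%N -> mcoeff m q = 0) ->
  `|meval x q| <= C * 2^-1 ^+ d * 2 ^+ n.
Proof.
move=> C0 R1 r0 Rr xr qC qd; have R0 : 0 < R by apply: lt_le_trans R1.
rewrite (mevalE_trunc _ (leqnn _)).
have h0 : 0 <= 2^-1 :> K by rewrite invr_ge0 ler0n.
apply: (@norm_sum_quarter _ 2^-1); rewrite ?mulr_ge0 ?exprn_ge0 ?lexx ?andbT //.
move=> m; have [md|dm] := ltnP (mdeg m) d.
  by rewrite qd // mul0r normr0 !mulr_ge0 ?exprn_ge0.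
rewrite normrM; apply: (@le_trans _ _ (C * R ^+ mdeg m * r ^+ mdeg m)).
  by apply: ler_pM; rewrite ?normr_ge0 ?norm_monomial_le.
rewrite -!mulrA ler_wpM2l // -exprMn.
apply: (@le_trans _ _ (2^-1 ^+ mdeg m * 2^-1 ^+ mdeg m)).
  rewrite -exprMn lerXn2r ?nnegrE ?mulr_ge0 ?(ltW r0) ?(ltW R0) //.
  by rewrite -invfM -natrM -[_^-1]mul1r ler_pdivlMr ?ltr0n // mulrC.
rewrite ler_wpM2r ?exprn_ge0 // -(subnK dm) exprD ler_piMl ?exprn_ge0 //.
by rewrite exprn_ile1 // invf_le1 ?ltr0n // ler1n.
Qed.

Lemma norm_mulm_le C1 C2 R p q m : 0 <= C1 -> 0 <= C2 -> 1 <= R ->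
  (forall m, `|mcoeff m p| <= C1 * R ^+ mdeg m) ->
  (forall m, `|mcoeff m q| <= C2 * R ^+ mdeg m) ->
  `|mcoeff m (p * q)| <= C1 * C2 * 2 ^+ n * (2 ^+ n * R) ^+ mdeg m.
Proof.
move=> C10 C20 R1 pC qC; have R0 : 0 < R by apply: lt_le_trans R1.
rewrite mcoeffM; apply: (le_trans (ler_norm_sum _ _ _)).
have key k : m == mnm_add k.1 k.2 ->
   `|mcoeff k.1 p * mcoeff k.2 q| <= C1 * C2 * R ^+ mdeg m.
  move=> /eqP ->; rewrite normrM mdegD exprD mulrACA.
  by apply: ler_pM; rewrite ?normr_ge0.
apply: (le_trans (ler_sum _ (fun k h => key (bmnm k.1, bmnm k.2) h))).
rewrite sumr_const -[leLHS]mulr_natr exprMn.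
apply: (@le_trans _ _ (C1 * C2 * R ^+ mdeg m * (2 ^+ n) ^+ (mdeg m).+1)).
  by rewrite ler_wpM2l ?mulr_ge0 ?exprn_ge0 ?(ltW R0) // -!natrX
    ler_nat card_splittings.
by rewrite exprS le_eqVlt; apply/orP; left; apply/eqP; ring.
Qed.

Lemma taylor1_bound (r u h : K) k : 0 <= r -> `|u| <= r -> `|u + h| <= r ->
  r * `|(u + h) ^+ k - u ^+ k| <= k%:R * `|h| * r ^+ k.
Proof.
move=> r0 ur uhr; elim: k => [|k IH].
  by rewrite !expr0 subrr normr0 mulr0 !mul0r.
have -> : (u + h) ^+ k.+1 - u ^+ k.+1 =
    (u + h) * ((u + h) ^+ k - u ^+ k) + h * u ^+ k by rewrite !exprS; ring.
apply: (le_trans (ler_wpM2l r0 (ler_normD _ _))).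
have -> : k.+1%:R * `|h| * r ^+ k.+1 = k%:R * `|h| * r ^+ k.+1 + `|h| * r ^+ k.+1.
  by rewrite -natr1; ring.
rewrite mulrDr; apply: lerD.
  rewrite normrM mulrCA (exprS r k) [leRHS]mulrCA; apply: ler_pM => //.
  by rewrite mulr_ge0.
rewrite normrM normrX mulrCA ler_wpM2l // exprS ler_wpM2l //.
by rewrite lerXn2r ?nnegrE.
Qed.

(** Multiplying by r ^ 2 avoids the negative exponents of the quotient form of
    this second-order estimate. *)
Lemma taylor2_bound (r u h : K) k : 0 <= r -> `|u| <= r -> `|u + h| <= r ->
  r ^+ 2 * `|(u + h) ^+ k - u ^+ k - h * (k%:R * u ^+ k.-1)|
    <= (k ^ 2)%:R * `|h| ^+ 2 * r ^+ k.
Proof.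
move=> r0 ur uhr; elim: k => [|k IH].
  by rewrite !expr0 subrr mul0r mulr0 subrr normr0 mulr0 !mul0r.
have -> : (u + h) ^+ k.+1 - u ^+ k.+1 - h * (k.+1%:R * u ^+ k.+1.-1) =
  u * ((u + h) ^+ k - u ^+ k - h * (k%:R * u ^+ k.-1))
  + h * ((u + h) ^+ k - u ^+ k).
  case: k {IH} => [|k]; rewrite /= ?exprS -?natr1; ring.
apply: (le_trans (ler_wpM2l (exprn_ge0 _ r0) (ler_normD _ _))).
apply: (@le_trans _ _ ((k ^ 2)%:R * `|h| ^+ 2 * r ^+ k.+1 +
                       k%:R * `|h| ^+ 2 * r ^+ k.+1)); last first.
  rewrite -!mulrDl -natrD !ler_wpM2r ?exprn_ge0 // ler_nat; nia.
rewrite mulrDr; apply: lerD.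
  rewrite normrM mulrCA (exprS r k) [leRHS]mulrCA; apply: ler_pM => //.
  by rewrite mulr_ge0 ?exprn_ge0.
rewrite normrM.
have -> : r ^+ 2 * (`|h| * `|(u + h) ^+ k - u ^+ k|) =
   `|h| * r * (r * `|(u + h) ^+ k - u ^+ k|) by ring.
have -> : k%:R * `|h| ^+ 2 * r ^+ k.+1 = `|h| * r * (k%:R * `|h| * r ^+ k).
  by rewrite (exprS r k); ring.
by rewrite ler_wpM2l ?mulr_ge0 // taylor1_bound.
Qed.

End PowerSeriesEstimates.

Section MevalTaylor.
Variables (K : numFieldType) (n : nat).

(** Second-order Taylor estimate with a constant independent of the polynomial:
    being uniform, it passes to the limit along partial sums and yields termwise
    differentiation.  The factor 4 per degree lost to the squares of the
    exponents explains the radius 1 / (8 R). *)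
Lemma meval_taylor (C R r h : K) (i : 'I_n) (x y : 'I_n -> K) (q : mpoly n K) :
  0 <= C -> 1 <= R -> 0 <= r -> 8 * (R * r) <= 1 ->
  (forall j, `|x j| <= r) -> `|y i| <= r ->
  y i = x i + h -> (forall j, j != i -> y j = x j) ->
  (forall m, `|mcoeff m q| <= C * R ^+ mdeg m) ->
  r ^+ 2 * `|meval y q - meval x q - h * meval x (mderiv i q)|
    <= C * `|h| ^+ 2 * 2 ^+ n.
Proof.
move=> C0 R1 r0 Rr xr yr yi yj qC; have R0 : 0 <= R := le_trans ler01 R1.
pose D := msize q.
have -> : meval x (mderiv i q) = \sum_(m : bmultinom n D) mcoeff m q *
    ((m i)%:R * x i ^+ (m i).-1 * \prod_(j | j != i) x j ^+ m j).
  rewrite {1}[q](mpolywE (leqnn _)) (linear_sum (mderiv i)) raddf_sum.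
  apply: eq_bigr => m _ /=.
  rewrite mderivZ mderivX !mevalZ mevalX (bigD1 i) //= mnmBE mnm1E eqxx subn1.
  rewrite -!mulrA; congr (_ * (_ * (_ * _))); apply: eq_bigr => j ji.
  by rewrite mnmBE mnm1E eq_sym (negbTE ji) subn0.
rewrite !(@mevalE_trunc _ _ D _ q (leqnn _)) mulr_sumr -!sumrB.
rewrite -[r ^+ 2]ger0_norm ?exprn_ge0 // -normrM mulr_sumr.
apply: (@norm_sum_quarter _ _ _ (4 * (R * r))).
- by rewrite mulr_ge0 ?exprn_ge0.
- rewrite mulr_ge0 ?mulr_ge0 // -[2^-1]mul1r ler_pdivlMr ?ltr0n // mulrAC.
  by rewrite -natrM.
move=> m.
have Ez z : \prod_j z j ^+ m j = z i ^+ m i * \prod_(j | j != i) z j ^+ m j :> K.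
  by rewrite (bigD1 i).
rewrite (Ez x) (Ez y) yi.
rewrite (eq_bigr (fun j => x j ^+ m j)) => [|j ji]; last by rewrite yj.
set P := \prod_(j | _) _.
rewrite [X in `|X|](_ : _ = mcoeff m q * (P * (r ^+ 2 *
  ((x i + h) ^+ m i - x i ^+ m i - h * ((m i)%:R * x i ^+ (m i).-1))))); last by ring.
have PP : `|P| * r ^+ m i <= r ^+ mdeg m.
  rewrite mdegE (bigD1 i) //= addnC exprD ler_wpM2r ?exprn_ge0 //.
  rewrite normr_prod expr_sum; apply: ler_prod => j _.
  by rewrite normr_ge0 normrX lerXn2r ?nnegrE.
have [E0 EE] := (normr_ge0 P, @taylor2_bound K r (x i) h (m i) r0 (xr i)).
rewrite normrM (normrM P) (normrM (r ^+ 2)) (ger0_norm (exprn_ge0 _ r0)).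
apply: (@le_trans _ _ (C * R ^+ mdeg m *
  (`|P| * ((m i ^ 2)%:R * `|h| ^+ 2 * r ^+ m i)))).
  apply: ler_pM => //; first by rewrite !mulr_ge0 ?exprn_ge0.
  by rewrite ler_wpM2l // EE // -yi.
rewrite [leLHS](_ : _ =
  C * R ^+ mdeg m * `|h| ^+ 2 * (m i ^ 2)%:R * (`|P| * r ^+ m i));
  last by ring.
rewrite !exprMn [leRHS](_ : _ =
  C * R ^+ mdeg m * `|h| ^+ 2 * 4 ^+ mdeg m * r ^+ mdeg m);
  last by ring.
apply: ler_pM => //; first by rewrite !mulr_ge0 ?exprn_ge0 ?ler0n.
  by rewrite mulr_ge0 ?exprn_ge0.
rewrite ler_wpM2l ?mulr_ge0 ?exprn_ge0 // -natrX ler_nat.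
apply: (@leq_trans (4 ^ m i)); last by rewrite leq_exp2l // mnm_le_mdeg.
by rewrite (_ : 4 = 2 ^ 2)%N // -expnM mulnC expnM leq_exp2r // ltnW // ltn_expl.
Qed.

End MevalTaylor.

Section LimitBounds.
Variable K : numFieldType.

Lemma limit_norm_le (u : nat -> K) (l B : K) :
  0 <= B -> u @ \oo --> l -> (forall d, `|u d| <= B) -> `|l| <= B.
Proof.
move=> B0 ul uB; case: (real_leP (normr_real l) (ger0_real B0)) => // Bl.
have e0 : 0 < `|l| - B by rewrite subr_gt0.
move/cvgrPdist_lt : ul => /(_ _ e0) [d _ /(_ d (leqnn d))] /= dl.
have : `|l| < `|l|.
  rewrite -[X in `|X| < _](subrK (u d)); apply: (le_lt_trans (ler_normD _ _)).
  by rewrite -ltrBrDr (lt_le_trans dl) // lerB.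
by rewrite ltxx.
Qed.

(** The archimedean property and completeness, in the weak form that power
    series require and that makes sense over both ground fields. *)
Definition geometric_small := forall e : K, 0 < e -> exists d, 2^-1 ^+ d < e.
Definition geometric_complete := forall (u : nat -> K) (C : K), 0 <= C ->
  (forall d e, `|u (d + e)%N - u d| <= C * 2^-1 ^+ d) ->
  exists l : K, u @ \oo --> l.

Lemma cvg_geometric0 (u : nat -> K) (C : K) : geometric_small -> 0 <= C ->
  (forall d, `|u d| <= C * 2^-1 ^+ d) -> u @ \oo --> (0 : K).
Proof.
move=> small C0 uC; apply/cvgrPdist_le => e e0.
have C1 : 0 < C + 1 by rewrite ltr_wpDl.
have [d de] := small (e / (C + 1)) (divr_gt0 e0 C1).
exists d => // k /= dk; rewrite sub0r normrN; apply: le_trans (uC k) _.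
have h0 : 0 <= 2^-1 :> K by rewrite invr_ge0.
have kd : 2^-1 ^+ k <= 2^-1 ^+ d :> K.
  rewrite -(subnK dk) exprD ler_piMl ?exprn_ge0 // exprn_ile1 //.
  by rewrite invf_le1 ?ltr0n // ler1n.
apply: (@le_trans _ _ ((C + 1) * (e / (C + 1)))); last first.
  by rewrite mulrC divfK // gt_eqF.
apply: ler_pM; rewrite ?exprn_ge0 // ?lerDl //.
exact: le_trans kd (ltW de).
Qed.

End LimitBounds.

(** * Sums of convergent power series *)

Section ConvergentSeries.
Variables (K : numFieldType) (n : nat).
Local Notation series := (multi_index n -> K).
Implicit Types (a b : series) (p q : mpoly n K) (m : multi_index n).

Definition convergent a := exists C R, [/\ 0 <= C, 1 <= R & bounded_by C R a].

Lemma bounded_by_le C C' R R' a : 0 <= C -> 0 <= R -> C <= C' -> R <= R' ->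
  bounded_by C R a -> bounded_by C' R' a.
Proof.
move=> C0 R0 CC RR Ca m; apply: le_trans (Ca m) _.
by apply: ler_pM; rewrite ?exprn_ge0 // lerXn2r ?nnegrE // (le_trans R0).
Qed.

Lemma convergent2 a b : convergent a -> convergent b ->
  exists C R, [/\ 0 <= C, 1 <= R, bounded_by C R a & bounded_by C R b].
Proof.
move=> [C [R [C0 R1 Ca]]] [C' [R' [C0' R1' Cb]]].
have [R0 R0'] := (le_trans ler01 R1, le_trans ler01 R1').
exists (C + C'), (R + R'); split.
- exact: addr_ge0.
- by rewrite ler_wpDr.
- by apply: bounded_by_le Ca; rewrite ?lerDl.
- by apply: bounded_by_le Cb; rewrite ?lerDr.
Qed.

Lemma bounded_by_trunc C R d a m : 0 <= C -> 0 <= R -> bounded_by C R a ->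
  `|mcoeff m (trunc d a)| <= C * R ^+ mdeg m.
Proof.
move=> C0 R0 Ca; rewrite mcoeff_trunc; case: ifP => _ //.
by rewrite normr0 mulr_ge0 ?exprn_ge0.
Qed.

Lemma bounded_by_mul C R a b : 0 <= C -> 1 <= R ->
  bounded_by C R a -> bounded_by C R b ->
  bounded_by (C * C * 2 ^+ n) (2 ^+ n * R) (fps_mul a b).
Proof.
move=> C0 R1 Ca Cb m; have R0 := le_trans ler01 R1.
rewrite (agree_mul (agree_trunc (d := (mdeg m).+1) a) (agree_trunc b)) //.
by apply: norm_mulm_le => // l; apply: bounded_by_trunc.
Qed.

Lemma admissible_convergent : admissible convergent.
Proof.
split.
- move=> k a b /convergent2 H /H{H}[C [R [C0 R1 Ca Cb]]].
  exists (`|k| * C + C), R; split => //; first by rewrite addr_ge0 ?mulr_ge0.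
  move=> m; have -> : (k *: a + b) m = k * a m + b m by [].
  have := ler_normD (k * a m) (b m); rewrite normrM => /le_trans; apply.
  by rewrite mulrDl -mulrA lerD // ler_wpM2l.
- move=> a b /convergent2 H /H{H}[C [R [C0 R1 Ca Cb]]].
  exists (C * C * 2 ^+ n), (2 ^+ n * R); split; last exact: bounded_by_mul.
    by rewrite !mulr_ge0 ?exprn_ge0.
  by rewrite mulr_ege1 // exprn_ege1 // ler1n.
- move=> i a [C [R [C0 R1 Ca]]]; have R0 := le_trans ler01 R1.
  exists (C * R), (2 * R); split; first exact: mulr_ge0.
    by rewrite mulr_ege1 // ler1n.
  move=> m; rewrite /fps_der normrMn -[leLHS]mulr_natr.
  rewrite [leRHS](_ : _ = C * R ^+ (mdeg m).+1 * 2 ^+ mdeg m); last first.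
    by rewrite exprMn exprS; ring.
  apply: ler_pM => //; first by rewrite -[(mdeg m).+1]addn1 -(mdeg1 i) -mdegD.
  rewrite -natrX ler_nat; apply: (@leq_trans (mdeg m).+1); last exact: ltn_expl.
  by rewrite ltnS mnm_le_mdeg.
- move=> a b [C [R [C0 R1 Ca]]] ba; exists C, R; split=> // m.
  exact: le_trans (ba m) (Ca m).
- move=> e a [C [R [C0 R1 Ca]]]; have R0 := le_trans ler01 R1.
  exists (C * R ^+ mdeg e), R; split => //; first by rewrite mulr_ge0 ?exprn_ge0.
  by move=> m; rewrite -mulrA -exprD addnC -mdegD.
- move=> p; exists (\sum_(m <- msupp p) `|mcoeff m p|), 1; split => //.
    by apply: sumr_ge0.
  move=> m; rewrite expr1n mulr1 /poly_series; have [mp|mp] := boolP (m \in msupp p).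
    by rewrite (bigD1_seq m) //= ?msupp_uniq // lerDl sumr_ge0.
  by rewrite memN_msupp_eq0 // normr0 sumr_ge0.
Qed.

Definition partial_sum a (x : 'rV[K]_n) (d : nat) : K := meval (x 0) (trunc d a).

Definition sums_to (r : K) (g : 'rV[K]_n -> K) a :=
  forall x : 'rV[K]_n, (forall i, `|x 0 i| < r) -> partial_sum a x @ \oo --> g x.

Definition represents (g : 'rV[K]_n -> K) a :=
  convergent a /\ exists2 r, 0 < r & sums_to r g a.

Lemma sums_to_le r r' g a : r' <= r -> sums_to r g a -> sums_to r' g a.
Proof. by move=> rr ga x xr; apply: ga => i; apply: lt_le_trans rr. Qed.

Lemma pos_lower_bound (r r' : K) : 0 < r -> 0 < r' ->
  exists s, [/\ 0 < s, s <= r & s <= r'].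
Proof.
move=> r0 r0'; have [rr|rr] := real_leP (gtr0_real r0) (gtr0_real r0').
  by exists r.
by exists r'; split => //; apply: ltW.
Qed.

Lemma small_radius (R r : K) : 0 < r -> 1 <= R ->
  exists s, [/\ 0 < s, s <= r & 8 * (R * s) <= 1].
Proof.
move=> r0 R1; have R0 := lt_le_trans ltr01 R1.
have R80 : 0 < 8 * R by rewrite mulr_gt0.
have [|s [s0 sr sR]] := @pos_lower_bound r (8 * R)^-1 r0; first by rewrite invr_gt0.
by exists s; split => //; rewrite mulrA mulrC -ler_pdivlMr // mul1r.
Qed.

Lemma near_polydisc (P : 'rV[K]_n -> Prop) :
  (\forall x \near (0 : 'rV[K]_n), P x) <->
  exists2 r, 0 < r & forall x : 'rV[K]_n, (forall i, `|x 0 i| < r) -> P x.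
Proof.
split=> [/nbhs_ballP[r /= r0 H]|[r r0 H]].
  exists r => // x xr; apply: H; split=> // i j; rewrite ord1.
  by rewrite /ball /= mxE sub0r normrN.
apply/nbhs_ballP; exists r => // x [_ xr]; apply: H => i.
by have := xr 0 i; rewrite /ball /= mxE sub0r normrN.
Qed.

Lemma lim_uniq (u : nat -> K) (l l' : K) :
  u @ \oo --> l -> u @ \oo --> l' -> l = l'.
Proof. by apply: cvg_unique; apply: norm_hausdorff. Qed.

Lemma represents_same g h a : represents g a -> represents h a ->
  \forall x \near (0 : 'rV[K]_n), g x = h x.
Proof.
move=> [_ [r r0 ga]] [_ [s s0 ha]]; have [t [t0 tr ts]] := pos_lower_bound r0 s0.
apply/near_polydisc; exists t => // x xt; apply: (@lim_uniq (partial_sum a x)).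
  exact: sums_to_le ga _ xt.
exact: sums_to_le ha _ xt.
Qed.

Lemma represents_linear k g h a b : represents g a -> represents h b ->
  represents (k *: g + h) (k *: a + b).
Proof.
move=> [ca [r r0 ga]] [cb [s s0 hb]]; split.
  exact: (adm_linear admissible_convergent).
have [t [t0 tr ts]] := pos_lower_bound r0 s0; exists t => // x xt.
have -> : partial_sum (k *: a + b) x =
    (fun d => k * partial_sum a x d + partial_sum b x d).
  apply/funext => d; rewrite /partial_sum -mevalZ -mevalD; congr (meval _ _).
  apply/mpolyP => m; rewrite mcoeffD mcoeffZ !mcoeff_trunc !fctE.
  by case: ifP => // _; rewrite mulr0 addr0.
apply: cvgD; last exact: sums_to_le hb _ xt.
by apply: cvgMr; exact: sums_to_le ga _ xt.
Qed.

Lemma partial_sum_tail C R r a (x : 'rV[K]_n) d e : 0 <= C -> 1 <= R -> 0 < r ->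
  8 * (R * r) <= 1 -> bounded_by C R a -> (forall i, `|x 0 i| <= r) ->
  `|partial_sum a x (d + e)%N - partial_sum a x d| <= C * 2 ^+ n * 2^-1 ^+ d.
Proof.
move=> C0 R1 r0 Rr Ca xr; have R0 := le_trans ler01 R1.
rewrite -mevalB mulrAC; apply: (norm_tail_le C0 R1 r0) => // [|m|m md].
- apply: le_trans Rr; apply: ler_wpM2r; first by rewrite mulr_ge0 // ltW.
  by rewrite ler_nat.
- rewrite mcoeffB !mcoeff_trunc; case: (ltnP (mdeg m) d) => md.
    by rewrite ltn_addr // subrr normr0 mulr_ge0 ?exprn_ge0.
  rewrite subr0; case: ifP => // _.
  by rewrite normr0 mulr_ge0 ?exprn_ge0.
- by rewrite mcoeffB !mcoeff_trunc md ltn_addr // subrr.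
Qed.

Hypotheses (small : geometric_small K) (complete : geometric_complete K).

Lemma partial_sum_cvg C R r a (x : 'rV[K]_n) : 0 <= C -> 1 <= R -> 0 < r ->
  8 * (R * r) <= 1 -> bounded_by C R a -> (forall i, `|x 0 i| <= r) ->
  exists l : K, partial_sum a x @ \oo --> l.
Proof.
move=> C0 R1 r0 Rr Ca xr; apply: (complete (C := C * 2 ^+ n)).
  by rewrite mulr_ge0 ?exprn_ge0.
by move=> d e; apply: partial_sum_tail Ca xr.
Qed.

Lemma convergent_represents a : convergent a -> exists g, represents g a.
Proof.
move=> ca; have [C [R [C0 R1 Ca]]] := ca.
have [r [r0 _ Rr]] := small_radius ltr01 R1.
exists (fun x => lim (partial_sum a x @ \oo)); split=> //; exists r => // x xr.
have [|l al] := partial_sum_cvg (x := x) C0 R1 r0 Rr Ca; first by move=> i; apply: ltW.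
by rewrite (cvg_lim (@norm_hausdorff _ _) al).
Qed.

(** The product of two partial sums and the partial sum of the product differ by
    a polynomial without terms of low degree, whose coefficients obey the bound of
    a product. *)
Lemma represents_mul g h a b : represents g a -> represents h b ->
  represents (g \* h) (fps_mul a b).
Proof.
move=> [ca [r r0 ga]] [cb [s s0 hb]]; split.
  exact: (adm_mul admissible_convergent).
have [C [R [C0 R1 Ca Cb]]] := convergent2 ca cb; have R0 := le_trans ler01 R1.
have [t [t0 tr ts]] := pos_lower_bound r0 s0.
have R1' : 1 <= 2 ^+ n * R by rewrite mulr_ege1 // exprn_ege1 // ler1n.
have [v [v0 vt Rv]] := small_radius t0 R1'.
exists v => // x xv.
have ax : partial_sum a x @ \oo --> g x by apply: sums_to_le ga _ xv; apply: le_trans tr.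
have bx : partial_sum b x @ \oo --> h x by apply: sums_to_le hb _ xv; apply: le_trans ts.
pose D d := partial_sum a x d * partial_sum b x d - partial_sum (fps_mul a b) x d.
suff D0 : D @ \oo --> (0 : K).
  have -> : partial_sum (fps_mul a b) x =
      (fun d => partial_sum a x d * partial_sum b x d - D d).
    by apply/funext => d; rewrite /D subKr.
  by rewrite -[X in _ --> X]subr0; apply: cvgB => //; apply: cvgM.
apply: (cvg_geometric0 (C := C * C * 2 ^+ n * 2 ^+ n)) => //.
  by rewrite !mulr_ge0 ?exprn_ge0.
move=> d; rewrite /D /partial_sum -mevalM -mevalB mulrAC.
have CC0 : 0 <= C * C * 2 ^+ n by rewrite !mulr_ge0 ?exprn_ge0.
apply: (norm_tail_le CC0 R1' v0) => [|i|m|m md].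
- apply: le_trans Rv; apply: ler_wpM2r; last by rewrite ler_nat.
  by rewrite mulr_ge0 ?(ltW v0) // mulr_ge0 ?exprn_ge0.
- exact/ltW.
- rewrite mcoeffB mcoeff_trunc; case: ifP => md.
    rewrite -(agree_mul (agree_trunc a) (agree_trunc b) md) subrr normr0.
    by rewrite mulr_ge0 // exprn_ge0 // mulr_ge0 ?exprn_ge0.
  by rewrite subr0; apply: norm_mulm_le => // l; apply: bounded_by_trunc.
- rewrite mcoeffB mcoeff_trunc md.
  by rewrite -(agree_mul (agree_trunc a) (agree_trunc b) md) subrr.
Qed.

Lemma represents_poly p : represents (fun x => meval (x 0) p) (poly_series p).
Proof.
split; first exact: (adm_poly admissible_convergent).
exists 1 => // x _; apply: cvg_near_cst; exists (msize p) => // d /= pd.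
rewrite /partial_sum; congr (meval _ _); apply/mpolyP => m; rewrite mcoeff_trunc.
case: ltnP => // dm; rewrite memN_msupp_eq0 //; apply/negP => /msize_mdeg_lt.
by rewrite ltnNge (leq_trans pd).
Qed.

End ConvergentSeries.

(** * Taylor series of analytic germs *)

Section AnalyticRealization.
Variables (K : numFieldType) (n : nat).
Local Notation series := (multi_index n -> K).
Hypotheses (small : geometric_small K) (complete : geometric_complete K).
Implicit Types (a b : series) (g h : 'rV[K]_n -> K).

Lemma trunc_der i d a : mderiv i (trunc d.+1 a) = trunc d (fps_der i a).
Proof.
apply/mpolyP => m; rewrite mcoeff_deriv !mcoeff_trunc mdegD mdeg1 addn1 ltnS.
by case: ifP => // _; rewrite mul0rn.
Qed.

(** The uniform Taylor estimate for partial sums survives in the limit, and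
    dividing it by the increment gives the directional derivative. *)
Lemma represents_der i g a : represents g a ->
  represents (fun x => 'D_(delta_mx 0 i) g x) (fps_der i a).
Proof.
move=> [ca [r r0 ga]]; split; first exact: (adm_der (admissible_convergent K n)).
have [C [R [C0 R1 Ca Cda]]] :=
  convergent2 ca (adm_der (admissible_convergent K n) i ca).
have [s [s0 sr Rs]] := small_radius r0 R1.
have R0 := le_trans ler01 R1.
have s20 : 0 < s / 2 by rewrite divr_gt0.
have s2s : s / 2 <= s by rewrite ler_pdivrMr // mulr_natr mulr2n lerDl ltW.
exists (s / 2) => // x xs2.
have xs j : `|x 0 j| <= s by apply: le_trans s2s; apply: ltW.
have [l xl] := partial_sum_cvg complete C0 R1 s0 Rs Cda xs.
suff -> : 'D_(delta_mx 0 i) g x = l by [].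
apply: cvg_lim; first exact: norm_hausdorff.
pose B := C * 2 ^+ n / s ^+ 2.
have B0 : 0 <= B by rewrite divr_ge0 ?mulr_ge0 ?exprn_ge0 // ltW.
have key (h : K) : `|h| < s / 2 ->
    `|g (h *: delta_mx 0 i + x) - g x - h * l| <= B * `|h| ^+ 2.
  move=> hs; set y := h *: delta_mx 0 i + x.
  have yj j : y 0 j = (if j == i then x 0 i + h else x 0 j).
    rewrite !mxE eqxx /= eq_sym; case: eqP => [->|_]; first by rewrite mulr1 addrC.
    by rewrite mulr0 add0r.
  have ys j : `|y 0 j| < s.
    rewrite yj; case: eqP => [_|_]; last exact: lt_le_trans s2s.
    rewrite (splitr s); apply: le_lt_trans (ltrD (xs2 i) hs); exact: ler_normD.
  have gy : partial_sum a y @ \oo --> g y by apply: sums_to_le ga _ ys.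
  have gx : partial_sum a x @ \oo --> g x.
    by apply: ga => j; apply: lt_le_trans sr; apply: lt_le_trans s2s.
  rewrite -cvg_shiftS in gy; rewrite -cvg_shiftS in gx.
  apply: (@limit_norm_le K (fun d =>
    partial_sum a y d.+1 - partial_sum a x d.+1 - h * partial_sum (fps_der i a) x d)).
  - by rewrite mulr_ge0 ?exprn_ge0.
  - by apply: cvgB; [exact: cvgB|exact: cvgMr].
  move=> d; rewrite /partial_sum -trunc_der /B mulrAC ler_pdivlMr ?exprn_gt0 // mulrC.
  rewrite [leRHS]mulrAC.
  apply: (@meval_taylor K n C R s h i (x 0) (y 0)) => //.
  - exact: ltW.
  - by rewrite ltW.
  - by rewrite yj eqxx.
  - by move=> j /negbTE ji; rewrite yj ji.
  - by move=> m; apply: bounded_by_trunc.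
apply/cvgrPdist_le => e e0.
have B10 : 0 < B + 1 by rewrite ltr_wpDl.
near=> t.
have t0 : t != 0 by near: t; exact: nbhs_dnbhs_neq.
have ts : `|t| < s / 2 by near: t; exact: dnbhs0_lt.
have te : `|t| < e / (B + 1) by near: t; apply: dnbhs0_lt; rewrite divr_gt0.
have -> : l - t^-1 *: ((g \o shift x) (t *: delta_mx 0 i) - g x) =
    - (t^-1 * (g (t *: delta_mx 0 i + x) - g x - t * l)).
  by rewrite mulrBr mulKf // opprB.
rewrite normrN normrM normfV ler_pdivrMl ?normr_gt0 //.
apply: le_trans (key t ts) _.
rewrite expr2 mulrCA ler_wpM2l //.
apply: (@le_trans _ _ ((B + 1) * `|t|)); first by rewrite ler_wpM2r // lerDl.
by rewrite mulrC -ler_pdivlMr // ltW.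
Unshelve. all: by end_near.
Qed.

Lemma partial_sum0 a d : partial_sum a 0 d.+1 = a mnm0.
Proof.
have m0d : (mdeg (mnm0 : multi_index n) < d.+1)%N by rewrite mdeg0.
rewrite /partial_sum meval_trunc (bigD1 (BMultinom m0d)) //= addrC.
rewrite [X in _ + _ * X]big1 ?mulr1 => [|i _]; last by rewrite mxE mnm0E expr0.
rewrite big1 ?add0r // => m m0; apply/eqP; rewrite mulf_eq0; apply/orP; right.
have [i mi] : exists i, m i != 0%N.
  apply: contrapT => no; case/eqP: m0; apply/val_inj/mnmP => i /=.
  rewrite mnm0E; apply/eqP; apply: contrapT => /negP mi; apply: no; by exists i.
by apply/prodf_eq0; exists i => //; rewrite mxE expr0n (negbTE mi).
Qed.

Lemma represents_at0 g a : represents g a -> g 0 = a mnm0.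
Proof.
move=> [_ [r r0 /(_ 0)]]; rewrite -cvg_shiftS => H.
apply: lim_uniq (H _) _ => [i|]; first by rewrite mxE normr0.
by rewrite (_ : [sequence _]_n = fun=> a mnm0) ?cvg_cst //; [exact: cvg_cst|
  apply/funext => d; apply: partial_sum0].
Qed.

(** The coefficients of a power series are the values at 0 of the iterated
    partial derivatives of its sum, up to factorials. *)
Lemma represents0_eq0 g a : represents g a ->
  (\forall x \near (0 : 'rV[K]_n), g x = 0) -> a = 0.
Proof.
move=> ga g0; apply/funext => m; rewrite [RHS]/(0 : K).
have [d] := ubnP (mdeg m); elim: d => // d IH in m g a ga g0 *; rewrite ltnS => md.
have [->|m0] := eqVneq m mnm0.
  by rewrite -(represents_at0 ga) (nbhs_singleton g0).
have [i mi] : exists i, m i != 0%N.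
  apply: contrapT => no; case/eqP: m0; apply/mnmP => i.
  rewrite mnm0E; apply/eqP; apply: contrapT => /negP mi; apply: no; by exists i.
have Um : mnm_add (mnm_sub m (mnm1 i)) (mnm1 i) = m.
  apply: submK; apply/mnm_lepP => j; rewrite mnm1E; case: eqP => // <-.
  by rewrite lt0n.
have H1 : \forall x \near (0 : 'rV[K]_n), 'D_(delta_mx 0 i) g x = 0.
  apply: filterS (nbhs_interior g0) => x gx.
  rewrite -[RHS](derive_cst (0 : K) x (delta_mx 0 i)).
  by apply: near_eq_derive.
have mUd : (mdeg (mnm_sub m (mnm1 i)) < d)%N.
  by apply: leq_trans md; rewrite -[in X in (_ <= X)%N]Um mdegD mdeg1 addn1.
have /eqP := IH _ _ _ (represents_der i ga) H1 mUd.
by rewrite /fps_der Um -scaler_nat scaler_eq0 pnatr_eq0 /= => /eqP.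
Qed.

Lemma partial_sumE a x :
  partial_sum a x = fun d => \sum_(m : bmultinom n d) a m * monomial_at x m.
Proof. by apply/funext => d; rewrite /partial_sum meval_trunc. Qed.

Lemma analytic_represents g : analytic_at0 g -> exists a, represents g a.
Proof.
move=> [a [r [M [r0 aM ag]]]]; exists a; split; last first.
  exists r => // x xr; rewrite partial_sumE; exact: ag.
have M0 : 0 <= M.
  by apply: le_trans (aM 0%N); apply: sumr_ge0 => m _; rewrite mulr_ge0 ?exprn_ge0 // ltW.
exists M, (1 + r^-1); split => //; first by rewrite lerDl invr_ge0 ltW.
move=> m; have md : (mdeg m < (mdeg m).+1)%N by [].
have h1 : `|a m| * r ^+ mdeg m <= M.
  apply: le_trans (aM (mdeg m).+1); rewrite (bigD1 (BMultinom md)) //= lerDl.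
  by apply: sumr_ge0 => l _; rewrite mulr_ge0 ?exprn_ge0 // ltW.
apply: (@le_trans _ _ (M * r^-1 ^+ mdeg m)).
  by rewrite exprVn ler_pdivlMr // exprn_gt0.
rewrite ler_wpM2l // lerXn2r ?nnegrE ?invr_ge0 ?lerDr ?(ltW r0) //.
by rewrite addr_ge0 // invr_ge0 ltW.
Qed.

Lemma represents_analytic g a : represents g a -> analytic_at0 g.
Proof.
move=> [[C [R [C0 R1 Ca]]] [r r0 ga]]; have R0 := le_trans ler01 R1.
have [s [s0 sr Rs]] := small_radius r0 R1.
exists a, s, (C * 2 ^+ n); split => // [d|x xs]; last first.
  by rewrite -partial_sumE; apply: sums_to_le ga _ xs.
rewrite -[leLHS]ger0_norm; last first.
  by apply: sumr_ge0 => m _; rewrite mulr_ge0 ?exprn_ge0 // ltW.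
apply: (@norm_sum_quarter _ _ _ (R * s)) => //.
  rewrite mulr_ge0 ?(ltW s0) //= -[2^-1]mul1r ler_pdivlMr ?ltr0n //.
  apply: le_trans Rs; rewrite mulrC ler_wpM2r ?ler_nat //.
  by rewrite mulr_ge0 // ltW.
move=> m; rewrite normrM normr_id [X in _ * X]ger0_norm ?exprn_ge0 ?(ltW s0) //.
by rewrite exprMn mulrA ler_wpM2r ?exprn_ge0 // ltW.
Qed.

Lemma realization_analytic :
  @realization K n (analytic_category K n) (@convergent K n) (@represents K n).
Proof.
split => /=.
- by move=> g a [].
- exact: represents_analytic.
- exact: analytic_represents.
- by move=> a; apply: convergent_represents.
- move=> g h a b ga hb; split=> [gh|ab]; last by apply: represents_same ga _; rewrite ab.
  apply/eqP; rewrite eq_sym -subr_eq0 -scaleN1r addrC; apply/eqP.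
  apply: represents0_eq0 (represents_linear (-1) ga hb) _.
  near=> x; have gx : g x = h x by near: x.
  change (-1 * g x + h x = 0); by rewrite gx mulN1r addNr.
- by move=> k g h a b; apply: represents_linear.
- by move=> g h a b; apply: represents_mul.
- by move=> i g a; apply: represents_der.
- by move=> p; apply: represents_poly.
Unshelve. all: by end_near.
Qed.

End AnalyticRealization.

(** * The real and the complex field *)

Section GroundFields.
Variable R : realType.

Lemma geometric_small_real : geometric_small R.
Proof.
move=> e e0; have h1 : `|2^-1 : R| < 1.
  by rewrite ger0_norm ?invr_ge0 // invf_lt1 ?ltr0n // ltr1n.
have /cvgrPdist_lt /(_ e e0) [d _ /(_ d (leqnn d))] := cvg_expr h1.
rewrite /= sub0r normrN ger0_norm; first by exists d.
by rewrite exprn_ge0 ?invr_ge0.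
Qed.

Lemma geometric_complete_real : geometric_complete R.
Proof.
move=> u C C0 uC; suff : cvg (u @ \oo) by move=> /cvg_ex[l ul]; exists l.
apply/cauchy_cvgP/cauchy_exP => e e0.
have C1 : 0 < C + 1 by rewrite ltr_wpDl.
have [d de] := geometric_small_real (divr_gt0 e0 C1).
exists (u d); exists d => // k /= dk; rewrite -(subnKC dk) /ball /= distrC.
apply: le_lt_trans (uC d (k - d)%N) _; rewrite ltr_pdivlMr // in de.
apply: le_lt_trans de; rewrite mulrC ler_wpM2l ?exprn_ge0 ?invr_ge0 //.
by rewrite lerDl.
Qed.

Local Notation C := (R[i] : numFieldType).

Lemma real_complex_half d : (2^-1 : C) ^+ d = real_complex R (2^-1 ^+ d).
Proof. by rewrite rmorphXn /= fmorphV rmorph_nat. Qed.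

Lemma ge0_complexE (x : C) : 0 <= x -> x = real_complex R (complex.Re x).
Proof. by move=> x0; rewrite RRe_real // ger0_real. Qed.

Lemma geometric_small_complex : geometric_small C.
Proof.
move=> e e0; have eE := ge0_complexE (ltW e0).
have [|d de] := @geometric_small_real (complex.Re e).
  by rewrite -ltcR -eE.
by exists d; rewrite real_complex_half eE ltcR.
Qed.

Lemma norm_Re_le (z : C) : real_complex R `|complex.Re z| <= `|z|.
Proof.
rewrite normc_def lecR -sqrtr_sqr ler_wsqrtr // lerDl sqr_ge0 //.
Qed.

Lemma norm_Im_le (z : C) : real_complex R `|complex.Im z| <= `|z|.
Proof.
rewrite normc_def lecR -sqrtr_sqr ler_wsqrtr // lerDr sqr_ge0 //.
Qed.

Lemma norm_le_Re_Im (z : C) :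
  `|z| <= real_complex R (`|complex.Re z| + `|complex.Im z|).
Proof.
rewrite normc_def lecR -[leRHS]ger0_norm ?addr_ge0 // -[leRHS]sqrtr_sqr.
rewrite ler_wsqrtr // sqrrD !real_normK ?num_real // lerD2r lerDl.
by rewrite mulrn_wge0 // mulr_ge0.
Qed.

(** The real and the imaginary parts satisfy the same bounds. *)
Lemma geometric_complete_complex : geometric_complete C.
Proof.
move=> u B B0 uB; pose b := complex.Re B.
have BE : B = real_complex R b by apply: ge0_complexE.
have b0 : 0 <= b by rewrite -lecR -BE.
have uBE d e : `|u (d + e)%N - u d| <= real_complex R (b * 2^-1 ^+ d).
  by rewrite rmorphM /= -BE -real_complex_half.
have [|l1 ul1] := geometric_complete_real (u := fun k => complex.Re (u k)) b0.
  move=> d e; rewrite -lecR; apply: le_trans (uBE d e).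
  by apply: le_trans (norm_Re_le _); rewrite raddfB.
have [|l2 ul2] := geometric_complete_real (u := fun k => complex.Im (u k)) b0.
  move=> d e; rewrite -lecR; apply: le_trans (uBE d e).
  by apply: le_trans (norm_Im_le _); rewrite raddfB.
exists (Complex l1 l2 : C); apply/cvgrPdist_le => e e0.
have eE := ge0_complexE (ltW e0).
have e20 : 0 < complex.Re e / 2 by rewrite divr_gt0 // -ltcR -eE.
move/cvgrPdist_le : ul1 => /(_ _ e20)[N1 _ H1].
move/cvgrPdist_le : ul2 => /(_ _ e20)[N2 _ H2].
exists (maxn N1 N2) => // k /=; rewrite geq_max => /andP[k1 k2].
apply: le_trans (norm_le_Re_Im _) _; rewrite eE lecR (splitr (complex.Re e)).
have {H1 H2} [H1 H2] := (H1 _ k1, H2 _ k2).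
by rewrite !raddfB; apply: lerD.
Qed.

End GroundFields.

(** * Vanishing of the cohomology *)

Theorem theorem3p8 (R : realType) (gr : ground) (reg : regularity) (n : nat)
  (p : {mpol (ground_field R gr)[n]}) (N k : nat) :
  let C := germ_category (ground_field R gr) n reg in
  let f := of_poly C p in
  (3 <= n)%N ->
  quasihomogeneous p N ->
  mpoly.meval (fun=> 0) p = 0 ->
  finite_codimension f ->
  (2 <= k <= n - 2)%N ->
  H_trivial f k.
Proof.
move=> C f _ qh _ fin kn; rewrite {}/f in fin *; rewrite {}/C in fin *.
case: reg fin => fin /=.
  apply: H_trivial_transfer qh fin kn; last exact: realization_formal.
  exact: admissible_formal.
have [small complete] : geometric_small (ground_field R gr) /\
    geometric_complete (ground_field R gr).
  case: gr {p qh fin} => /=.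
    by split; [exact: geometric_small_real|exact: geometric_complete_real].
  by split; [exact: geometric_small_complex|exact: geometric_complete_complex].
apply: H_trivial_transfer qh fin kn; last exact: realization_analytic.
exact: admissible_convergent.
Qed.
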